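(* Let $r\ge 2$ and $n\ge 1$ be integers, let $\pi_1,\ldots,\pi_n$ be independent uniformly distributed random permutations of $\{1,\ldots,r\}$, and let $F_r$ be Friedman's statistic $$F_r=\sum_{j=1}^r W_j^2,\qquad W_j=\frac{1}{\sqrt n}\sum_{i=1}^n X_{ij},\qquad X_{ij}=\frac{\sqrt{12}}{\sqrt{r(r+1)}}\Big(\pi_i(j)-\frac{r+1}{2}\Big).$$ Then, for every $h\in C_b^4(\mathbb{R}^+)$, $$|\mathbb{E}h(F_r)-\chi_{(r-1)}^2h|\le 10797\, r^5 n^{-1} h_4,$$ where $\chi_{(r-1)}^2h$ denotes the expectation $\mathbb{E}h(Y)$ for $Y\sim\chi^2_{(r-1)}$ (chi-square distribution with $r-1$ degrees of freedom).
   Context: $C_b^k(I)$ denotes the class of real-valued functions on $I$ whose derivatives of order $k$ all exist and are bounded; $\mathbb{R}^+=[0,\infty)$. For a function $h$, $h_m=\sum_{j=1}^m {m\brace j}\|h^{(j)}\|$, where $\|\cdot\|$ is the supremum norm (over the domain of $h$) and ${m\brace j}=\frac{1}{j!}\sum_{i=0}^j(-1)^{j-i}\binom{j}{i}i^m$ is the Stirling number of the second kind. *)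

(* Defs.v *)
From HB Require Import structures.
From mathcomp Require Import all_boot all_order all_algebra perm.
From mathcomp Require Import all_classical all_reals all_analysis.

Set Implicit Arguments.
Unset Strict Implicit.
Unset Printing Implicit Defensive.

Import Order.TTheory GRing.Theory Num.Theory.
Import numFieldNormedType.Exports.

Local Open Scope classical_set_scope.
Local Open Scope ring_scope.

(* A function on R^+ = [0, +oo[ is represented by h : R -> R of which only the
   values on `[0, +oo[ are ever used: difference quotients are taken along
   points of `[0, +oo[ (so that the derivative at 0 is the right derivative). *)
Section functions_on_halfline.
Variable R : realType.
Implicit Types (h : R -> R) (x : R).

Definition quotient_Rplus h x : R -> R := fun y => (h y - h x) / (y - x).

Definition derivable_Rplus h x : Prop :=
  cvg (quotient_Rplus h x @ within `[0, +oo[ x^').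

Definition derive_Rplus h : R -> R :=
  fun x => lim (quotient_Rplus h x @ within `[0, +oo[ x^').

Definition deriven_Rplus (k : nat) h : R -> R := iter k derive_Rplus h.

(* Boundedness is required of the derivative of order k only. *)
Definition Cb_Rplus (k : nat) h : Prop :=
  (forall j, (j < k)%N -> {in `[0, +oo[, forall x,
     derivable_Rplus (deriven_Rplus j h) x}) /\
  [bounded deriven_Rplus k h x | x in `[0, +oo[].

Definition supnorm_Rplus h : \bar R :=
  ereal_sup [set `|h x|%:E | x in `[0, +oo[].

Definition stirling2 (m j : nat) : R :=
  (j`!%:R)^-1 * \sum_(0 <= i < j.+1) (-1) ^+ (j - i) * 'C(j, i)%:R * i%:R ^+ m.

(* Extended-real valued: +oo as soon as one of the derivatives is unbounded. *)
Definition hnorm h (m : nat) : \bar R :=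
  (\sum_(1 <= j < m.+1)
     (stirling2 m j)%:E * supnorm_Rplus (deriven_Rplus j h))%E.

End functions_on_halfline.

Section random_permutations.
Context d (T : measurableType d) (R : realType) (P : probability T R).
Variables r n : nat.
Implicit Type p : 'I_n -> T -> 'S_r.

Definition perm_rv (s : T -> 'S_r) : Prop :=
  forall A : {set 'S_r}, measurable [set w | s w \in A].

Definition uniform_perm (s : T -> 'S_r) : Prop :=
  forall t : 'S_r, P [set w | s w = t] = (#|{: 'S_r}|%:R^-1)%:E.

Definition independent_perms p : Prop :=
  forall (J : {set 'I_n}) (A : 'I_n -> {set 'S_r}),
    P [set w | forall i, i \in J -> p i w \in A i] =
    (\prod_(i in J) P [set w | p i w \in A i])%E.

End random_permutations.

(* 'S_r acts on {0, ..., r-1}, so the rank of j under s is (s j).+1. *)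
Section friedman.
Variables (R : realType) (r n : nat) (s : 'I_n -> 'S_r).

Definition friedman_X (i : 'I_n) (j : 'I_r) : R :=
  Num.sqrt 12 / Num.sqrt (r%:R * (r%:R + 1)) *
  ((s i j).+1%:R - (r%:R + 1) / 2).

Definition friedman_W (j : 'I_r) : R :=
  (Num.sqrt n%:R)^-1 * \sum_(i < n) friedman_X i j.

Definition friedman_F : R := \sum_(j < r) friedman_W j ^+ 2.

End friedman.

(* The chi-square distribution with k degrees of freedom, as the law of
   Z_1^2 + ... + Z_k^2 for independent standard normal Z_1, ..., Z_k: the
   law for k.+1 is that of Y + Z^2 under the product of the law of Y for k and
   of the standard normal law of Z. *)
Section chi_square.
Variable R : realType.
Local Notation mR := (measurableTypeR R).

Definition add_sqr (yz : mR * mR) : mR := (yz.1 : R) + (yz.2 : R) ^+ 2.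

Lemma measurable_add_sqr : measurable_fun [set: mR * mR] add_sqr.
Proof.
apply: (@measurable_realfun.measurable_funD _ (mR * mR)%type R).
  exact: measurable_fst.
apply: (@measurable_realfun.measurable_funX _ (mR * mR)%type R).
exact: measurable_snd.
Qed.

HB.instance Definition _ :=
  isMeasurableFun.Build _ _ _ _ add_sqr measurable_add_sqr.

Fixpoint chi_square_prob (k : nat) : probability mR R :=
  if k is k'.+1 then
    distribution (chi_square_prob k' \x normal_prob (0 : R) 1)%E add_sqr
  else \d_((0 : R) : mR).

End chi_square.

(* Main.v *)
Require Import Defs.
From HB Require Import structures.
From mathcomp Require Import all_boot all_order all_algebra perm.
From mathcomp Require Import all_classical all_reals all_analysis measurable_realfun.
From mathcomp Require Import ring lra.

Set Implicit Arguments.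
Unset Strict Implicit.
Unset Printing Implicit Defensive.

Import Order.TTheory GRing.Theory Num.Theory.
Import numFieldNormedType.Exports.

Local Open Scope classical_set_scope.
Local Open Scope ring_scope.

(** Write k = r - 1.  The rank vector X_i = (X_i1, ..., X_ir) lies in the
    hyperplane of vectors with zero sum, has the constant squared length k, a
    symmetric law (reverse the ranks) and the orthogonal projection onto that
    hyperplane as its covariance (exchangeability leaves no other choice, see
    [perm_mean_dot_sqr]).  Moreover F_r is the squared length of the sum of the
    vectors X_i / sqrt n.  Let Z be a standard Gaussian vector of the
    hyperplane, that is, the combination of an orthonormal basis with
    independent standard normal coefficients ([centered_basis]).  It has the
    same covariance and a symmetric law, and |Z|^2 has the chi-square
    distribution with k degrees of freedom ([integral_chi_square_halfline]).

    The proof is Lindeberg's: the X_i are replaced one at a time by independent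
    copies of Z.  For a step x of size s = n^(-1/2) from w, write
    |w + s x|^2 = q + 2 b + c with q = |w|^2, b = s <w, x>, c = s^2 |x|^2.
    Averaging Taylor's formula for h over x and - x cancels all odd powers of b,
    and b^2 <= q c turns what is left beyond h(q) + h'(q) c + 2 h''(q) b^2 into
    an error of order c^2, that is n^(-2), with the coefficient
    |h^(1)| + 7 |h^(2)| + 6 |h^(3)| + |h^(4)| ([taylor_sym]).  The three main
    terms depend on the law of x through its covariance only, so they agree for
    X_i and Z ([imean_taylor], applied to both in [vmean_step_dist]).  The n
    replacements therefore cost O(1/n) in total ([lindeberg_bound]).  The
    coefficients 1, 7, 6, 1 are the Stirling numbers in h_4 ([hnorm4E]).

    The error of one replacement grows like the fourth power of the length of
    the current point.  It is averaged over the steps already present: the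
    polynomials [quartic t] in |w|^2 are such that one rank step maps
    [quartic t] below [quartic (t + s^2)], so that n steps cost a bounded
    factor.  The Gaussian steps need no such induction, as m steps of size s add
    up to one of size s sqrt m ([vmean_conv]).  Moments of the normal law come
    from the single formula E exp((1 - u^2) Z^2 / 2) = 1 / u.

    On the probability side, the expectation over n independent uniform
    permutations is the average over all n-tuples of permutations
    ([expectation_perms]), hence n iterated averages over one permutation
    ([iter_step_ffun]).  Gaussian means of functions on the hyperplane are
    iterated one-dimensional integrals ([vmean]).  If some derivative of h of
    order 1 to 4 is unbounded then h_4 is infinite and the bound is trivial. *)

(** * The normal law on the line *)

Section gaussian_line.
Variable R : realType.
Implicit Types (f : R -> R) (m s t z : R).
Local Notation mu := (@lebesgue_measure R).
Local Notation N01 := (normal_prob (0 : R) 1).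
Local Notation mR := (measurableTypeR R).

(** The density of the normal law agrees almost everywhere with its
    Radon-Nikodym derivative, through which integrals change measure. *)
Lemma ge0_integral_normal_prob m s (f : _ -> \bar R) :
  measurable_fun setT f -> (forall x, 0 <= f x)%E ->
  (\int[normal_prob m s]_x f x = \int[mu]_x (f x * (normal_pdf m s x)%:E))%E.
Proof.
move=> mf f0.
have dom := normal_prob_dominates m s.
rewrite -(@Radon_Nikodym_SigmaFinite.change_of_variables _ _ _
  (normal_prob m s) mu)//.
have intRN := @Radon_Nikodym_SigmaFinite.f_integrable _ _ _
  (normal_prob m s) mu dom.
have mpdf : measurable_fun [set: mR] (fun x => (normal_pdf m s x)%:E).
  by apply/measurable_EFinP; exact: measurable_normal_pdf.
apply: ge0_ae_eq_integral => //=.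
- by apply: emeasurable_funM => //; exact: measurable_int intRN.
- exact: emeasurable_funM.
- by move=> x _; rewrite mule_ge0//; exact: Radon_Nikodym_SigmaFinite.f_ge0.
- by move=> x _; rewrite mule_ge0// lee_fin normal_pdf_ge0.
- apply: ae_eqe_mul2l; apply: integral_ae_eq => //.
  by move=> E _ mE; rewrite -Radon_Nikodym_SigmaFinite.f_integral.
Qed.

Lemma normal_pdf_affine m s z : 0 < s ->
  normal_pdf m s (m + s * z) * s = normal_pdf 0 1 z.
Proof.
move=> s0; rewrite !normal_pdfE ?oner_eq0 ?gt_eqF// /normal_peak /normal_fun.
rewrite -[s ^+ 2 * pi *+ 2]mulrnAr sqrtrM ?sqr_ge0// sqrtr_sqr gtr0_norm//.
rewrite subr0 expr1n mul1r [m + _ - m]addrAC subrr add0r.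
have -> : - (s * z) ^+ 2 / (s ^+ 2 *+ 2) = - z ^+ 2 / (1 *+ 2).
  by field; rewrite gt_eqF.
by field; rewrite !gt_eqF// sqrtr_gt0 mulrn_wgt0// pi_gt0.
Qed.

Lemma ge0_integral_normal_affine m s f : 0 < s -> continuous f ->
  (forall x, 0 <= f x) ->
  (\int[mu]_x (f x * normal_pdf m s x)%:E =
   \int[N01]_z (f (m + s * z))%:E)%E.
Proof.
move=> s0 cf f0.
pose F z := m + s * z.
have F'E : F^`()%classic = cst s.
  apply/funext => x; rewrite derive1E /F deriveD// deriveM//.
  by rewrite !derive_cst derive_id scaler0 addr0 add0r/= [LHS]mulr1.
have cF : continuous F.
  move=> x; apply: cvgD; first exact: cvg_cst.
  by apply: cvgM; [exact: cvg_cst|exact: cvg_id].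
rewrite (@increasing_ge0_integration_by_substitutionT _ F).
- rewrite ge0_integral_normal_prob//; last 2 first.
    apply/measurable_EFinP; apply: (measurableT_comp (f := f)).
      exact: continuous_measurable_fun.
    exact: continuous_measurable_fun.
  - by move=> z; rewrite lee_fin.
  apply: eq_integral => z _; rewrite F'E -EFinM; congr (_%:E).
  rewrite [LHS]/= /F -mulrA; congr (_ * _).
  exact: normal_pdf_affine.
- by move=> x y xy; rewrite /F ltrD2l ltr_pM2l.
- by rewrite F'E => x; exact: cvg_cst.
- by rewrite F'E; exact: is_cvg_cst.
- by rewrite F'E; exact: is_cvg_cst.
- by move=> x; rewrite /F; apply: derivableD => //; apply: derivableM.
- rewrite (_ : F = (fun z => z * s + m)); last first.
    by apply/funext => z; rewrite /F addrC mulrC.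
  by apply: cvg_comp (cvg_addrr_Ny m); exact: gt0_cvgMlNy.
- rewrite (_ : F = (fun z => z * s + m)); last first.
    by apply/funext => z; rewrite /F addrC mulrC.
  by apply: cvg_comp (cvg_addrr m); exact: gt0_cvgMly.
- by move=> x; apply: cvgM; [exact: cf|apply: continuous_normal_pdf; rewrite gt_eqF].
- by move=> x; rewrite mulr_ge0// normal_pdf_ge0.
Qed.

(** The joint density of (sY + tZ, Y) at (x, y), for independent standard
    normal Y and Z, factored in both orders: law of Y times conditional law
    of sY + tZ, and law of sY + tZ times conditional law of Y. Both
    exponents are the same quadratic form, with the square completed
    differently. *)
Lemma normal_pdf_conv s t x y : 0 < s -> 0 < t ->
  normal_pdf (s * y) t x * normal_pdf 0 1 y =
  normal_pdf 0 (Num.sqrt (s ^+ 2 + t ^+ 2)) x *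
  normal_pdf (s * x / (s ^+ 2 + t ^+ 2)) (t / Num.sqrt (s ^+ 2 + t ^+ 2)) y.
Proof.
move=> s0 t0.
have st0 : 0 < s ^+ 2 + t ^+ 2 by rewrite addr_gt0// exprn_gt0.
have r0 : 0 < Num.sqrt (s ^+ 2 + t ^+ 2) by rewrite sqrtr_gt0.
have r2 := sqr_sqrtr (ltW st0).
set r := Num.sqrt (s ^+ 2 + t ^+ 2) in r0 r2 *.
rewrite !normal_pdfE ?oner_eq0 ?gt_eqF ?divr_gt0// /normal_peak /normal_fun.
have sq a : 0 < a -> Num.sqrt (a ^+ 2 * pi *+ 2) = a * Num.sqrt (pi *+ 2) :> R.
  by move=> a0; rewrite -mulrnAr sqrtrM ?sqr_ge0// sqrtr_sqr gtr0_norm.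
rewrite !sq ?divr_gt0// mul1r.
have p0 : 0 < Num.sqrt (pi *+ 2 : R) by rewrite sqrtr_gt0 mulrn_wgt0// pi_gt0.
set p := Num.sqrt _ in p0 *.
rewrite mulrACA -expRD [RHS]mulrACA -expRD; congr (_ * expR _).
  by field; rewrite !gt_eqF.
rewrite expr_div_n r2; field.
by rewrite !gt_eqF.
Qed.

(** Stability of the normal law. After exchanging the integrals of the joint
    density, [normal_pdf_conv] leaves a conditional density of total mass 1. *)
Lemma ge0_integral_normal_conv s t f : 0 < s -> 0 < t -> continuous f ->
  (forall x, 0 <= f x) ->
  (\int[N01]_y \int[N01]_z (f (s * y + t * z))%:E =
   \int[N01]_z (f (Num.sqrt (s ^+ 2 + t ^+ 2) * z))%:E)%E.
Proof.
move=> s0 t0 cf f0.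
have st0 : 0 < s ^+ 2 + t ^+ 2 by rewrite addr_gt0// exprn_gt0.
have r0 : 0 < Num.sqrt (s ^+ 2 + t ^+ 2) by rewrite sqrtr_gt0.
pose G (yx : mR * mR) : \bar R :=
  (f yx.2 * normal_pdf (s * yx.1) t yx.2 * normal_pdf 0 1 yx.1)%:E.
have mf : measurable_fun [set: mR] f by exact: continuous_measurable_fun.
have m1 : measurable_fun [set: mR * mR] (fun yx : mR * mR => f yx.2).
  by apply: (measurableT_comp mf); exact: measurable_snd.
have m2 : measurable_fun [set: mR * mR]
    (fun yx : mR * mR => normal_pdf (s * yx.1) t yx.2).
  rewrite (_ : (fun _ => _) =
      normal_pdf 0 t \o (fun yx : mR * mR => yx.2 - s * yx.1)); last first.
    by apply/funext => yx; rewrite /= !normal_pdfE ?gt_eqF// /normal_fun subr0.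
  apply: (measurableT_comp (measurable_normal_pdf 0 t)).
  apply: measurable_funB; first exact: measurable_snd.
  by apply: measurable_funM => //; exact: measurable_fst.
have m3 : measurable_fun [set: mR * mR]
    (fun yx : mR * mR => normal_pdf 0 1 yx.1).
  apply: (measurableT_comp (measurable_normal_pdf 0 1)).
  exact: measurable_fst.
have mG : measurable_fun setT G.
  by apply/measurable_EFinP; do 2 apply: measurable_funM => //.
have G0 yx : (0 <= G yx)%E.
  by rewrite lee_fin !mulr_ge0// normal_pdf_ge0.
under eq_integral do rewrite -ge0_integral_normal_affine//.
pose G1 (yx : mR * mR) : \bar R := (f yx.2 * normal_pdf (s * yx.1) t yx.2)%:E.
have mG1 : measurable_fun setT G1.
  by apply/measurable_EFinP; apply: measurable_funM.
have G10 yx : (0 <= G1 yx)%E by rewrite lee_fin mulr_ge0// normal_pdf_ge0.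
rewrite [LHS]ge0_integral_normal_prob//=; last 2 first.
  exact: (measurable_fun_fubini_tonelli_F G1).
  by move=> y; apply: integral_ge0 => x _; exact: (G10 (y, x)).
transitivity (\int[mu]_y \int[mu]_x G (y, x))%E.
  apply: eq_integral => y _; rewrite -ge0_integralZr//=; last 3 first.
  - exact: (measurableT_comp mG1 (pair1_measurable y)).
  - by move=> x _; rewrite lee_fin !mulr_ge0// normal_pdf_ge0.
  - by rewrite lee_fin normal_pdf_ge0.
rewrite fubini_tonelli//.
transitivity (\int[mu]_x (f x * normal_pdf 0 (Num.sqrt (s ^+ 2 + t ^+ 2)) x)%:E)%E.
  apply: eq_integral => x _; rewrite /G/=.
  under eq_integral do rewrite -mulrA normal_pdf_conv// mulrA EFinM.
  rewrite ge0_integralZl//=.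
  - by rewrite integral_normal_pdf mule1.
  - by apply/measurable_EFinP; exact: measurable_normal_pdf.
  - by move=> y _; rewrite lee_fin normal_pdf_ge0.
  - by rewrite lee_fin mulr_ge0// normal_pdf_ge0.
rewrite ge0_integral_normal_affine//.
by apply: eq_integral => z _; rewrite add0r.
Qed.

End gaussian_line.

(** * Exponential integrability under the standard normal law *)

Section gaussian_moments.
Variable R : realType.
Implicit Types (u z : R).
Local Notation mu := (@lebesgue_measure R).
Local Notation N01 := (normal_prob (0 : R) 1).
Local Notation mR := (measurableTypeR R).

Lemma ge0_integral_normal_opp (f : _ -> \bar R) : measurable_fun [set: mR] f ->
  (forall x, 0 <= f x)%E ->
  (\int[N01]_z f (- z)%R = \int[N01]_z f z)%E.
Proof.
move=> mf f0; have mo : measurable_fun [set: mR] (-%R : mR -> mR).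
  by apply: continuous_measurable_fun => x; exact: cvgN.
have mfo : measurable_fun [set: mR] (fun z => f (- z)).
  exact: (measurableT_comp mf mo).
rewrite !ge0_integral_normal_prob//.
transitivity (\int[pushforward mu (-%R : mR -> mR)]_z
    (f z * (normal_pdf 0 1 z)%:E))%E.
  rewrite [RHS](ge0_integral_pushforward mo).
  - apply: eq_integral => z _.
    by rewrite /= !normal_pdfE ?oner_eq0// /normal_fun !subr0 sqrrN.
  - exact: measurableT.
  - apply: emeasurable_funM => //.
    by apply/measurable_EFinP; exact: measurable_normal_pdf.
  - by move=> z _; rewrite mule_ge0// lee_fin normal_pdf_ge0.
by apply: eq_measure_integral => //= A mA _; exact: lebesgue_measureN.
Qed.

(** The integrand times the standard normal density is 1 / u times the
    density of the centred normal law of standard deviation 1 / u. For u =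
    1/2 this gives integrability, for u near 1 the variance. *)
Lemma integral_normal_expR_sqr u : 0 < u ->
  (\int[N01]_z (expR ((1 - u ^+ 2) / 2 * z ^+ 2))%:E = (u^-1)%:E)%E.
Proof.
move=> u0; rewrite ge0_integral_normal_prob//; last first.
  apply/measurable_EFinP; apply: measurableT_comp => //.
  by apply: measurable_funM => //; exact: measurable_funX.
transitivity (\int[mu]_z ((u^-1)%:E * (normal_pdf 0 u^-1 z)%:E))%E.
  apply: eq_integral => z _; rewrite -!EFinM; congr (_%:E).
  rewrite !normal_pdfE ?oner_eq0 ?gt_eqF ?invr_gt0// /normal_fun /normal_peak.
  rewrite !subr0 expr1n mul1r -[u^-1 ^+ 2 * pi *+ 2]mulrnAr.
  rewrite sqrtrM ?sqr_ge0// sqrtr_sqr gtr0_norm ?invr_gt0// mulrCA -expRD.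
  rewrite invfM invrK !mulrA mulVf ?gt_eqF// mul1r; congr (_ * expR _).
  by field; rewrite gt_eqF.
rewrite ge0_integralZl//=.
- by rewrite integral_normal_pdf mule1.
- by apply/measurable_EFinP; exact: measurable_normal_pdf.
- by move=> y _; rewrite lee_fin normal_pdf_ge0.
- by rewrite lee_fin invr_ge0 ltW.
Qed.

Lemma integrable_normal_expR_sqr u : 0 < u ->
  N01.-integrable setT (fun z => (expR ((1 - u ^+ 2) / 2 * z ^+ 2))%:E).
Proof.
move=> u0; apply/integrableP; split.
  apply/measurable_EFinP; apply: measurableT_comp => //.
  by apply: measurable_funM => //; exact: measurable_funX.
under eq_integral do rewrite /= ger0_norm ?expR_ge0//.
by rewrite integral_normal_expR_sqr// ltry.
Qed.

(** Taken at u = 1/2 in [integral_normal_expR_sqr], where the exponent is 3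
    z^2 / 8: n |z| <= n^2 + z^2 / 4 leaves room. *)
Lemma poly_le_expR_sqr (n : nat) z :
  (1 + `|z|) ^+ n <= expR (n%:R ^+ 2) * expR ((1 - (2^-1) ^+ 2) / 2 * z ^+ 2).
Proof.
rewrite -expRD.
apply: (@le_trans _ _ (expR (`|z|) ^+ n)).
  by rewrite lerXn2r ?nnegrE ?expR_ge0 ?addr_ge0// expR_ge1Dx.
rewrite -expRM_natr ler_expR -[z ^+ 2]real_normK ?num_real//.
by have := sqr_ge0 (n%:R - `|z| / 2); have := sqr_ge0 `|z|; nra.
Qed.

Lemma integrable_normal_poly (f : R -> R) (C : R) (n : nat) :
  continuous f -> (forall z, `|f z| <= C * (1 + `|z|) ^+ n) ->
  N01.-integrable setT (EFin \o f).
Proof.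
move=> cf fC.
have mf : measurable_fun [set: mR] f by exact: continuous_measurable_fun.
pose e z : R := expR ((1 - (2^-1) ^+ 2) / 2 * z ^+ 2).
have C0 : 0 <= C.
  by have := fC 0; rewrite normr0 addr0 expr1n mulr1; apply: le_trans.
have ie : N01.-integrable setT (EFin \o e).
  by apply: integrable_normal_expR_sqr; rewrite invr_gt0.
have ieC := integrableZl measurableT (C * expR (n%:R ^+ 2)) ie.
apply: le_integrable ieC => //.
- exact/measurable_EFinP.
- move=> z _; rewrite lee_fin (le_trans (fC z))//.
  rewrite [leRHS]ger0_norm ?mulr_ge0 ?expR_ge0//.
  by rewrite -mulrA ler_wpM2l// poly_le_expR_sqr.
Qed.

End gaussian_moments.

(** * Functions with polynomially growing Lipschitz constants *)

Section polylip.
Variable R : realType.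
Implicit Types V : normedModType R.

(** A class of functions that contains the polynomials and h(|x|^2) for
    Lipschitz h, is closed under sums and products, and is preserved by
    Gaussian averaging in one direction. Its members are continuous and
    integrable for the normal law, so iterated Gaussian integrals of them
    raise no integrability or measurability question. Requiring local
    Lipschitz constants, and not just growth and continuity, is what makes
    averages continuous without appeal to dominated convergence. *)
Definition polylip V (F : V -> R) := exists C n,
  forall x y, `|F x - F y| <= C * `|x - y| * ((1 + `|x|) * (1 + `|y|)) ^+ n.

Lemma wge1 V (x : V) : 1 <= 1 + `|x|. Proof. by rewrite lerDl. Qed.

Lemma wge0 V (x : V) : 0 <= 1 + `|x|. Proof. exact: le_trans (wge1 x). Qed.

Lemma wwge1 V (x y : V) : 1 <= (1 + `|x|) * (1 + `|y|).
Proof. by rewrite -[leLHS]mulr1 ler_pM// wge1. Qed.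

Lemma wwge0 V (x y : V) : 0 <= (1 + `|x|) * (1 + `|y|).
Proof. exact: le_trans (wwge1 x y). Qed.

Lemma polylipP V (F : V -> R) : polylip F -> exists C n, 0 <= C /\
  forall x y, `|F x - F y| <= C * `|x - y| * ((1 + `|x|) * (1 + `|y|)) ^+ n.
Proof.
move=> [C [n FC]]; exists `|C|, n; split=> // x y; apply: le_trans (FC x y) _.
by rewrite -!mulrA ler_wpM2r ?ler_norm// mulr_ge0// exprn_ge0// wwge0.
Qed.

Lemma polylip_growth V (F : V -> R) : polylip F -> exists C n, 0 <= C /\
  forall x, `|F x| <= C * (1 + `|x|) ^+ n.
Proof.
move=> /polylipP[C [n [C0 FC]]]; exists (`|F 0| + C), n.+1; split.
  by rewrite addr_ge0.
move=> x; have := FC x 0; rewrite subr0 normr0 addr0 mulr1 => Fx.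
have w1 := wge1 x.
have wn1 : 1 <= (1 + `|x|) ^+ n by rewrite exprn_ege1.
apply: (@le_trans _ _ (`|F 0| + C * `|x| * (1 + `|x|) ^+ n)).
  by rewrite -[F x](subrK (F 0)) (le_trans (ler_normD _ _))// addrC lerD2l.
rewrite mulrDl lerD//.
  by rewrite ler_peMr// exprn_ege1.
by rewrite exprS mulrA ler_wpM2r ?(le_trans _ wn1)// ler_wpM2l// lerDr.
Qed.

Lemma polylip_cst V (c : R) : polylip (fun _ : V => c).
Proof. by exists 0, 0%N => x y; rewrite subrr normr0 !mul0r. Qed.

(** Two functions of the class are compared with one common power of the
    weight, any sufficiently large one: sums and products then reduce to
    arithmetic. *)
Lemma polylip_weight V (F : V -> R) : polylip F -> exists C n, 0 <= C /\
  forall m x y, (n <= m)%N ->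
    let W := ((1 + `|x|) * (1 + `|y|)) ^+ m in
    `|F x - F y| <= C * `|x - y| * W /\ `|F x| <= C * W /\ `|F y| <= C * W.
Proof.
move=> lF; have [A [i [A0 FA]]] := polylip_growth lF.
have [C [n [C0 FC]]] := polylipP lF.
exists (A + C), (i + n)%N; split; first by rewrite addr_ge0.
move=> m x y im W.
have W0 : 0 <= W by rewrite exprn_ge0// wwge0.
have wW j : (j <= m)%N -> ((1 + `|x|) * (1 + `|y|)) ^+ j <= W.
  by move=> jm; rewrite ler_weXn2l// wwge1.
have im' : (i <= m)%N by apply: leq_trans im; rewrite leq_addr.
have nm : (n <= m)%N by apply: leq_trans im; rewrite leq_addl.
split; last split.
- rewrite (le_trans (FC x y))// ler_pM ?mulr_ge0 ?exprn_ge0 ?wwge0 ?wW//.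
  by rewrite ler_wpM2r// lerDr.
- rewrite (le_trans (FA x))// ler_pM ?exprn_ge0 ?wge0 ?lerDl//.
  rewrite (le_trans _ (wW _ im'))// lerXn2r ?nnegrE ?wwge0 ?wge0//.
  by rewrite ler_peMr ?wge0 ?wge1.
- rewrite (le_trans (FA y))// ler_pM ?exprn_ge0 ?wge0 ?lerDl//.
  rewrite (le_trans _ (wW _ im'))// lerXn2r ?nnegrE ?wwge0 ?wge0//.
  by rewrite ler_peMl ?wge0 ?wge1.
Qed.

Lemma polylipD V (F G : V -> R) : polylip F -> polylip G ->
  polylip (fun x => F x + G x).
Proof.
move=> /polylip_weight[C [n [C0 FC]]] /polylip_weight[D [m [D0 GD]]].
exists (C + D), (n + m)%N => x y.
have [F1 _] := FC _ x y (leq_addr m n).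
have [G1 _] := GD _ x y (leq_addl n m).
by rewrite opprD addrACA (le_trans (ler_normD _ _))// -mulrA mulrDl !mulrA lerD.
Qed.

Lemma polylipM V (F G : V -> R) : polylip F -> polylip G ->
  polylip (fun x => F x * G x).
Proof.
move=> /polylip_weight[C [n [C0 FC]]] /polylip_weight[D [m [D0 GD]]].
exists (C * D + C * D), (n + m + (n + m))%N => x y.
have [F1 [F2 F3]] := FC _ x y (leq_addr m n).
have [G1 [G2 G3]] := GD _ x y (leq_addl n m).
have -> : F x * G x - F y * G y = (F x - F y) * G x + F y * (G x - G y).
  by ring.
rewrite exprD; set W := _ ^+ (n + m) in F1 F2 F3 G1 G2 G3 *.
rewrite (le_trans (ler_normD _ _))// !normrM.
have -> : (C * D + C * D) * `|x - y| * (W * W) =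
  (C * `|x - y| * W) * (D * W) + (C * W) * (D * `|x - y| * W) by ring.
by rewrite lerD// ler_pM.
Qed.

Lemma polylip_sum V (I : Type) (r : seq I) (P : pred I) (F : I -> V -> R) :
  (forall i, polylip (F i)) -> polylip (fun x => \sum_(i <- r | P i) F i x).
Proof.
move=> lF; elim: r => [|i r IH].
  by under eq_fun do rewrite big_nil; exact: polylip_cst.
under eq_fun do rewrite big_cons; case: (P i) => //; exact: polylipD.
Qed.

Lemma polylipZ V (c : R) (F : V -> R) : polylip F -> polylip (fun x => c * F x).
Proof. by move=> lF; apply: polylipM => //; exact: polylip_cst. Qed.

Lemma polylipN V (F : V -> R) : polylip F -> polylip (fun x => - F x).
Proof. by move=> /(polylipZ (-1)); under eq_fun do rewrite mulN1r. Qed.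

Lemma polylipB V (F G : V -> R) : polylip F -> polylip G ->
  polylip (fun x => F x - G x).
Proof. by move=> lF lG; apply: polylipD => //; exact: polylipN. Qed.

Lemma polylipX V (n : nat) (F : V -> R) : polylip F ->
  polylip (fun x => F x ^+ n).
Proof.
move=> lF; elim: n => [|n IH].
  by under eq_fun do rewrite expr0; exact: polylip_cst.
by under eq_fun do rewrite exprS; exact: polylipM.
Qed.

Lemma polylip_lip V (M : R) (F G : V -> R) : 0 <= M -> polylip G ->
  (forall x y, `|F x - F y| <= M * `|G x - G y|) -> polylip F.
Proof.
move=> M0 [C [n GC]] FG; exists (M * C), n => x y.
by rewrite (le_trans (FG x y))// -!mulrA ler_wpM2l// mulrA.
Qed.

Lemma polylip_norm V (F : V -> R) : polylip F -> polylip (fun x => `|F x|).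
Proof.
move=> lF; apply: (polylip_lip ler01 lF) => x y; rewrite mul1r.
exact: ler_dist_dist.
Qed.

Lemma polylip_comp V (W : normedModType R) (F : W -> R) (g : V -> W) (C : R) : 0 <= C ->
  polylip F -> (forall x y, `|g x - g y| <= C * `|x - y|) ->
  polylip (F \o g).
Proof.
move=> C0 /polylipP[D [n [D0 FD]]] gC.
pose K := 1 + `|g 0| + C.
have K1 : 1 <= K by rewrite /K -addrA lerDl addr_ge0.
have K0 : 0 <= K by exact: le_trans K1.
have gK x : 1 + `|g x| <= K * (1 + `|x|).
  have := gC x 0; rewrite subr0 => gx0.
  have : `|g x| <= `|g 0| + C * `|x|.
    by rewrite -[g x](subrK (g 0)) (le_trans (ler_normD _ _))// addrC lerD2l.
  have := normr_ge0 x; have := normr_ge0 (g 0); rewrite /K; nra.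
exists (D * C * (K * K) ^+ n), n => x y /=.
rewrite (le_trans (FD _ _))//.
have -> : D * C * (K * K) ^+ n * `|x - y| * ((1 + `|x|) * (1 + `|y|)) ^+ n =
  (D * (C * `|x - y|)) * ((K * (1 + `|x|)) * (K * (1 + `|y|))) ^+ n.
  by rewrite !exprMn; ring.
rewrite ler_pM ?mulr_ge0 ?exprn_ge0 ?wwge0//; first by rewrite ler_wpM2l.
by rewrite lerXn2r ?nnegrE ?wwge0 ?mulr_ge0 ?wge0// ler_pM ?wge0.
Qed.

Lemma polylip_shift V (w : V) (s : R) (F : V -> R) : polylip F ->
  polylip (fun x => F (w + s *: x)).
Proof.
move=> lF; apply: (@polylip_comp _ _ F (fun x => w + s *: x) `|s|) => // x y.
by rewrite opprD addrACA subrr add0r -scalerBr normrZ.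
Qed.

Lemma polylip_line V (w e : V) (F : V -> R) : polylip F ->
  polylip (fun z : R => F (w + z *: e)).
Proof.
move=> lF; apply: (@polylip_comp _ _ F (fun z : R => w + z *: e) `|e|) => // x y.
by rewrite opprD addrACA subrr add0r -scalerBl normrZ mulrC.
Qed.

Lemma polylip_continuous V (f : V -> R) : polylip f -> continuous f.
Proof.
move=> /polylipP[C [n [C0 fC]]] x.
pose K := C * ((1 + `|x|) * (2 + `|x|)) ^+ n.
have K0 : 0 <= K.
  by rewrite mulr_ge0// exprn_ge0// mulr_ge0 ?wge0// addr_ge0.
apply/cvgrPdist_le => /= e e0.
have d0 : 0 < Num.min 1 (e / (K + 1)).
  by rewrite lt_min ltr01/= divr_gt0// ltr_wpDl.
near=> y.
have : `|x - y| <= Num.min 1 (e / (K + 1)).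
  by near: y; apply: cvgr_dist_le d0; exact: cvg_id.
rewrite le_min ler_pdivlMr ?ltr_wpDl// => /andP[xy1 xye].
have yx : 1 + `|y| <= 2 + `|x|.
  have : `|y| <= `|x| + `|x - y|.
    rewrite distrC -{1}[y](subrK x) addrC; exact: ler_normD.
  lra.
rewrite (le_trans (fC x y))// (le_trans _ xye)//.
rewrite mulrAC mulrC ler_wpM2l// (@le_trans _ _ K) ?lerDl//.
rewrite ler_wpM2l// lerXn2r ?nnegrE ?wwge0 ?mulr_ge0 ?wge0 ?addr_ge0//.
by rewrite ler_wpM2l// wge0.
Unshelve. all: by end_near. Qed.

End polylip.

(** * One-dimensional Gaussian means *)

Section gaussian_mean.
Variable R : realType.
Implicit Types (f g : R -> R) (V : normedModType R).
Local Notation N01 := (normal_prob (0 : R) 1).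
Local Notation mR := (measurableTypeR R).

Definition gmean f : R := \int[N01]_z f z.

Lemma polylip_id : polylip (fun z : R => z).
Proof. by exists 1, 0%N => x y; rewrite expr0 mulr1 mul1r. Qed.

Lemma polylip_integrable f : polylip f -> N01.-integrable setT (EFin \o f).
Proof.
move=> lf; have [C [n [_ fC]]] := polylip_growth lf.
exact: integrable_normal_poly (polylip_continuous lf) fC.
Qed.

Lemma EFin_gmean f : polylip f -> (gmean f)%:E = (\int[N01]_z (f z)%:E)%E.
Proof.
move=> lf; rewrite /gmean /Rintegral fineK//.
exact: integrable_fin_num (polylip_integrable lf).
Qed.

Lemma eq_gmean f g : f =1 g -> gmean f = gmean g.
Proof. by move=> /funext ->. Qed.

Lemma gmean_cst (c : R) : gmean (fun=> c) = c.
Proof.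
rewrite /gmean Rintegral_cst// (_ : fine _ = 1) ?mulr1//.
exact: (congr1 fine (probability_setT N01)).
Qed.

Lemma gmeanD f g : polylip f -> polylip g ->
  gmean (fun z => f z + g z) = gmean f + gmean g.
Proof. by move=> lf lg; apply: RintegralD => //; exact: polylip_integrable. Qed.

Lemma gmeanZ c f : polylip f -> gmean (fun z => c * f z) = c * gmean f.
Proof. by move=> lf; apply: RintegralZl => //; exact: polylip_integrable. Qed.

Lemma gmeanB f g : polylip f -> polylip g ->
  gmean (fun z => f z - g z) = gmean f - gmean g.
Proof. by move=> lf lg; apply: RintegralB => //; exact: polylip_integrable. Qed.

Lemma le_gmean f g : polylip f -> polylip g -> (forall z, f z <= g z) ->
  gmean f <= gmean g.
Proof.
move=> lf lg fg; apply: le_Rintegral => //; exact: polylip_integrable.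
Qed.

Lemma ler_norm_gmean f : polylip f -> `|gmean f| <= gmean (fun z => `|f z|).
Proof. by move=> lf; apply: le_normr_Rintegral => //; exact: polylip_integrable. Qed.

(** Reduces linear identities between Gaussian means to nonnegative
    functions, for which the measure-theoretic statements hold without
    integrability. *)
Lemma polylip_ge0_split f : polylip f -> exists g,
  [/\ polylip g, forall z, 0 <= g z & forall z, 0 <= f z + g z].
Proof.
move=> lf; exists (fun z => `|f z|); split => //; first exact: polylip_norm.
by move=> z; have := ler_norm (- f z); rewrite normrN; lra.
Qed.

Lemma polylip_affine f (a s : R) : polylip f -> polylip (fun z => f (a + s * z)).
Proof. by move=> lf; exact: (@polylip_shift _ _ a s f). Qed.

Lemma polylip_opp f : polylip f -> polylip (fun z => f (- z)).
Proof.
move=> /(polylip_affine 0 (-1)); congr (polylip _).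
by apply/funext => z; rewrite add0r mulN1r.
Qed.

Lemma gmeanN f : polylip f -> gmean (fun z => f (- z)) = gmean f.
Proof.
move=> lf; have [g [lg g0 fg0]] := polylip_ge0_split lf.
have ge0N k : polylip k -> (forall z, 0 <= k z) ->
    gmean (fun z => k (- z)) = gmean k.
  move=> lk k0; rewrite /gmean /Rintegral.
  rewrite (ge0_integral_normal_opp (f := EFin \o k))//.
  apply/measurable_EFinP.
  exact: continuous_measurable_fun (polylip_continuous lk).
have lfg := polylipD lf lg.
have := ge0N _ lfg fg0; rewrite !gmeanD//; try exact: polylip_opp.
by rewrite (ge0N g)//; exact: addIr.
Qed.

(** The weight is submultiplicative, 1 + |u + z e| <= (1 + |u|) (1 + |z|
    |e|), so the factor depending on z integrates to a constant. *)
Lemma polylip_gmean V (F : V -> R) (e : V) : polylip F ->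
  polylip (fun x => gmean (fun z => F (x + z *: e))).
Proof.
move=> lF; have [C [n [C0 FC]]] := polylipP lF.
pose w (z : R) : R := 1 + `|z| * `|e|.
have lw : polylip w.
  apply: polylipD; first exact: polylip_cst.
  by apply: polylipM; [apply: polylip_norm; exact: polylip_id|exact: polylip_cst].
have w1 z : 1 <= w z by rewrite lerDl mulr_ge0.
exists (C * gmean (fun z => (w z * w z) ^+ n)), n => x y.
have lx u : polylip (fun z : R => F (u + z *: e)) by exact: polylip_line.
rewrite -gmeanB// (le_trans (ler_norm_gmean _))//; first exact: polylipB.
have lww : polylip (fun z => (w z * w z) ^+ n).
  by apply: polylipX; exact: polylipM.
rewrite -mulrA mulrAC -gmeanZ//; apply: le_gmean.
- by apply: polylip_norm; exact: polylipB.
- exact: polylipZ.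
move=> z; rewrite (le_trans (FC _ _))// opprD addrACA subrr addr0 -!mulrA.
rewrite ler_wpM2l// ler_wpM2l// -exprMn.
have H u : 1 + `|u + z *: e| <= (1 + `|u|) * w z.
  have := ler_normD u (z *: e); rewrite normrZ /w.
  have := normr_ge0 u; have := mulr_ge0 (normr_ge0 z) (normr_ge0 e); nra.
rewrite lerXn2r ?nnegrE ?wwge0//.
  by rewrite !mulr_ge0 ?wge0// ?(le_trans _ (w1 z)).
rewrite (_ : _ * _ * _ = ((1 + `|x|) * w z) * ((1 + `|y|) * w z)); last by ring.
by rewrite ler_pM ?wge0.
Qed.

(** Measurability is for the product sigma-algebra of the plane: a
    superlevel set of a continuous function is open, hence a countable union
    of boxes with rational centres and sizes. *)
Lemma measurable_polylip2 (G : R * R -> R) : polylip G ->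
  measurable_fun [set: mR * mR] G.
Proof.
move=> lG; have cG := polylip_continuous lG.
apply: (measurability _ (RGenOInfty.measurableE R)) => // _ [_ [r ->] <-].
rewrite setTI.
pose box (q1 q2 q3 : rat) : set (mR * mR) :=
  [set y | `|ratr q1 - y| < ratr q3] `*` [set z | `|ratr q2 - z| < ratr q3].
have mball (q q' : rat) : measurable ([set y | `|ratr q - y| < ratr q'] : set mR).
  rewrite (_ : [set _ | _] = ball (ratr q : R) (ratr q')).
    exact: measurable_ball.
  by rewrite -ball_normE.
rewrite (_ : _ @^-1` _ = \bigcup_q1 \bigcup_q2 \bigcup_q3
    (if `[< box q1 q2 q3 `<=` G @^-1` `]r, +oo[%classic >]
     then box q1 q2 q3 else set0)).
  do 3 (apply: bigcupT_measurable_rat => ?).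
  by case: ifP => // _; apply: measurableX; exact: mball.
apply/seteqP; split => [p rp|p [q1 _ [q2 _ [q3 _]]]]; last first.
  by case: ifPn => // /asboolP; exact.
have : \forall q \near p, r < G q.
  by move: rp; rewrite /= in_itv/= andbT => rp; apply: (cvgr_gt _ (cG p)).
move=> /nbhs_ballP[e /= e0 pe].
have [q3] : exists q, ratr q \in `]0, (e / 2)[ by apply: rat_in_itvoo; lra.
rewrite in_itv/= => /andP[q30 q3e].
have near_rat (y : R) : exists q : rat, `|ratr q - y| < ratr q3.
  have [q] : exists q, ratr q \in `](y - ratr q3), (y + ratr q3)[.
    by apply: rat_in_itvoo; lra.
  by rewrite in_itv/= => /andP[? ?]; exists q; rewrite ltr_norml; apply/andP; split; lra.
have [q1 q1p] := near_rat p.1; have [q2 q2p] := near_rat p.2.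
exists q1 => //; exists q2 => //; exists q3 => //.
rewrite asboolT//= => z [/= q1z q2z]; rewrite in_itv/= andbT; apply: pe.
split => /=; rewrite -ball_normE /ball_/= ltr_norml.
- move: q1p q1z; rewrite !ltr_norml => /andP[? ?] /andP[? ?].
  apply/andP; split; lra.
move: q2p q2z; rewrite !ltr_norml => /andP[? ?] /andP[? ?].
  apply/andP; split; lra.
Qed.

Lemma gmean_swap V (F : V -> R) (x a b : V) : polylip F ->
  gmean (fun y => gmean (fun z => F (x + y *: a + z *: b))) =
  gmean (fun z => gmean (fun y => F (x + y *: a + z *: b))).
Proof.
move=> lF.
pose G (p : mR * mR) := F (x + p.1 *: a + p.2 *: b).
have lG : polylip (G : R * R -> R).
  apply: (@polylip_comp _ _ _ F (fun p : R * R => x + p.1 *: a + p.2 *: b)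
    (`|a| + `|b|)) => //.
  move=> p q.
  have -> : x + p.1 *: a + p.2 *: b - (x + q.1 *: a + q.2 *: b) =
      (p.1 - q.1) *: a + (p.2 - q.2) *: b.
    rewrite !scalerBl opprD addrACA; congr (_ + _).
    by rewrite opprD addrACA subrr add0r.
  rewrite (le_trans (ler_normD _ _))// !normrZ mulrDl [`|a| * _]mulrC.
  rewrite [`|b| * _]mulrC lerD// ler_wpM2r//.
    by rewrite prod_normE le_max lexx.
  by rewrite prod_normE le_max lexx orbT.
have mG := measurable_polylip2 lG.
have lG2 y : polylip (fun z => G (y, z)) by exact: (polylip_line (x + y *: a) b lF).
have lG1 z : polylip (fun y => G (y, z)).
  rewrite /G/= (_ : (fun _ => _) = (fun y => F ((x + z *: b) + y *: a))).
    exact: polylip_line.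
  by apply/funext => y; rewrite addrAC.
have lG3 (H : V -> R) : polylip H ->
    polylip (fun y : R => gmean (fun z => H (x + y *: a + z *: b))).
  by move=> lH; exact: (polylip_line x a (polylip_gmean b lH)).
have lG4 : polylip (fun z : R => gmean (fun y => G (y, z))).
  rewrite (_ : (fun _ => _) = fun z : R => gmean (fun y => F (x + z *: b + y *: a))).
    exact: (polylip_line x b (polylip_gmean a lF)).
  by apply/funext => z; apply: eq_gmean => y; rewrite /G/= addrAC.
apply: EFin_inj; rewrite (EFin_gmean (lG3 _ lF)) (EFin_gmean lG4).
transitivity (\int[N01]_y \int[N01]_z (G (y, z))%:E)%E.
  by apply: eq_integral => y _; exact: (EFin_gmean (lG2 y)).
rewrite (@Fubini _ _ _ _ _ N01 N01 (EFin \o G)).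
  by apply: eq_integral => z _; exact/esym/(EFin_gmean (lG1 z)).
have lFa : polylip (fun x => `|F x|) by exact: polylip_norm.
apply/integrable12ltyP; first exact/measurable_EFinP.
rewrite (_ : integral _ _ _ =
    (gmean (fun y => gmean (fun z => `|G (y, z)|)))%:E) ?ltry//.
rewrite (EFin_gmean (lG3 _ lFa)).
by apply: eq_integral => y _; exact/esym/(EFin_gmean (polylip_norm (lG2 y))).
Qed.

(** [ge0_integral_normal_conv] for signed functions; s = 0 occurs when no
    Gaussian step precedes. *)
Lemma gmean_conv f (s t : R) : 0 <= s -> 0 < t -> polylip f ->
  gmean (fun y => gmean (fun z => f (s * y + t * z))) =
  gmean (fun z => f (Num.sqrt (s ^+ 2 + t ^+ 2) * z)).
Proof.
move=> s0 t0 lf; have [<-|sN0] := eqVneq 0 s.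
  under eq_gmean do under eq_gmean do rewrite mul0r add0r.
  by rewrite gmean_cst expr0n add0r sqrtr_sqr gtr0_norm.
have {s0 sN0}s0 : 0 < s by rewrite lt_neqAle sN0.
have lin k a u : polylip k -> polylip (fun z : R => k (a + u * z)).
  exact: polylip_affine.
have lin0 k u : polylip k -> polylip (fun z : R => k (u * z)).
  by move=> /(lin _ 0 u); under eq_fun do rewrite add0r.
have lmean k : polylip k ->
    polylip (fun y : R => gmean (fun z => k (s * y + t * z))).
  move=> lk; have := polylip_gmean t (lin0 _ 1 lk).
  move=> /(lin0 _ s); congr polylip; apply/funext => y; apply: eq_gmean => z.
  by rewrite mul1r [z *: t]mulrC.
have ge0conv k : polylip k -> (forall z, 0 <= k z) ->
    gmean (fun y => gmean (fun z => k (s * y + t * z))) =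
    gmean (fun z => k (Num.sqrt (s ^+ 2 + t ^+ 2) * z)).
  move=> lk k0; apply: EFin_inj; rewrite (EFin_gmean (lmean _ lk)).
  rewrite (EFin_gmean (lin0 _ _ lk)).
  rewrite -ge0_integral_normal_conv//; last exact: polylip_continuous.
  by apply: eq_integral => y _; rewrite EFin_gmean//; exact: lin.
have [g [lg g0 fg0]] := polylip_ge0_split lf.
have lfg := polylipD lf lg.
pose r := Num.sqrt (s ^+ 2 + t ^+ 2).
have eL : gmean (fun y => gmean (fun z => f (s * y + t * z) + g (s * y + t * z)))
    = gmean (fun y => gmean (fun z => f (s * y + t * z))) +
      gmean (fun y => gmean (fun z => g (s * y + t * z))).
  rewrite -(gmeanD (lmean _ lf) (lmean _ lg)); apply: eq_gmean => y.
  exact: (gmeanD (lin _ (s * y) t lf) (lin _ (s * y) t lg)).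
have eR := gmeanD (lin0 _ r lf) (lin0 _ r lg).
have := ge0conv _ lfg fg0; rewrite /= eL eR (ge0conv _ lg g0).
exact: addIr.
Qed.

Lemma gmean_id : gmean (fun z => z) = 0.
Proof.
have := gmeanN polylip_id; under eq_gmean do rewrite -mulN1r.
by rewrite gmeanZ; [lra|exact: polylip_id].
Qed.

Lemma polylip_Xn n : polylip (fun z : R => z ^+ n).
Proof. by apply: polylipX; exact: polylip_id. Qed.

(** How moment bounds are read off: any polynomial inequality below the
    exponential integrates to an inequality between moments and 1 / u. *)
Lemma gmean_le_expR f (a b : R) u : 0 < u -> polylip f ->
  (forall z, a + b * f z <= expR ((1 - u ^+ 2) / 2 * z ^+ 2)) ->
  a + b * gmean f <= u^-1.
Proof.
move=> u0 lf fe.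
have lg : polylip (fun z => a + b * f z).
  by apply: polylipD; [exact: polylip_cst|exact: polylipZ].
have -> : a + b * gmean f = gmean (fun z => a + b * f z).
  by rewrite gmeanD ?gmeanZ ?gmean_cst//; [exact: polylip_cst|exact: polylipZ].
rewrite -lee_fin -integral_normal_expR_sqr// EFin_gmean//.
apply: le_integral => //; first exact: polylip_integrable.
  exact: integrable_normal_expR_sqr.
by move=> z _; rewrite lee_fin.
Qed.

(** Since 1 + y <= exp y, the second moment m satisfies 1 + (1 - u^2) m/2 <=
    1/u for all u > 0. Both sides are 1 at u = 1, so their derivatives there
    agree: m = 1. The proof inserts explicit values of u on either side of
    1. *)
Lemma gmean_sqr : gmean (fun z => z ^+ 2) = 1.
Proof.
have H u : 0 < u -> 1 + (1 - u ^+ 2) / 2 * gmean (fun z => z ^+ 2) <= u^-1.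
  move=> u0; apply: gmean_le_expR => // [|z]; last exact: expR_ge1Dx.
  exact: polylip_Xn.
have m0 : 0 <= gmean (fun z => z ^+ 2).
  by apply: Rintegral_ge0 => z _; exact: sqr_ge0.
set m := gmean _ in H m0 *.
have {}H u : 0 < u -> (1 - u) * (u * (1 + u) * m - 2) <= 0.
  (* Clearing denominators exposes the common factor 1 - u. *)
  move=> u0; have := H u u0; rewrite -[u^-1]mul1r ler_pdivlMr//; nra.
apply/eqP; rewrite eq_le !leNgt; apply/andP; split; apply/negP => m1.
  (* At u = 1 - e the second factor is positive if m > 1. *)
  pose e := (m - 1) / (3 * m).
  have em : e * (3 * m) = m - 1 by rewrite /e divfK// gt_eqF//; lra.
  have e0 : 0 < e by rewrite divr_gt0//; lra.
  have := H (1 - e); rewrite opprB addrCA subrr addr0 pmulr_rle0//.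
  move=> /(_ _); nra.
(* At u = 1 + e the second factor is negative if m < 1. *)
pose e := (1 - m) / 4.
have em : 4 * e = 1 - m by rewrite /e; field.
have := H (1 + e); rewrite opprD addrA subrr add0r mulNr oppr_le0.
rewrite pmulr_rge0; last by lra.
move=> /(_ _); nra.
Qed.

(** From 1 + y^2 / 2 <= exp y with y = 3 z^2 / 8, that is u = 1/2: a crude
    but short bound for the fourth moment, whose value is 3. *)
Lemma gmean_X4 : gmean (fun z => z ^+ 4) <= 15.
Proof.
have : 1 + 9 / 128 * gmean (fun z => z ^+ 4) <= (2^-1)^-1.
  apply: gmean_le_expR => // [|z]; first exact: polylip_Xn.
  have := @expR_ge1Dxn R ((1 - 2^-1 ^+ 2) / 2 * z ^+ 2) 1.
  rewrite (_ : 2`! = 2)//; move=> /(_ _) h; apply: le_trans (h _).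
    by rewrite le_eqVlt; apply/orP; left; apply/eqP; field.
  by have := sqr_ge0 z; nra.
rewrite invrK; lra.
Qed.

(** From 1 + y^4 / 24 <= exp y with y = 3 z^2 / 8. *)
Lemma gmean_X8 : gmean (fun z => z ^+ 8) <= 1214.
Proof.
have : 1 + 81 / (4096 * 24) * gmean (fun z => z ^+ 8) <= (2^-1)^-1.
  apply: gmean_le_expR => // [|z]; first exact: polylip_Xn.
  have := @expR_ge1Dxn R ((1 - 2^-1 ^+ 2) / 2 * z ^+ 2) 3.
  rewrite (_ : 4`! = 24)//; move=> /(_ _) h; apply: le_trans (h _).
    by rewrite le_eqVlt; apply/orP; left; apply/eqP; field.
  by have := sqr_ge0 z; nra.
rewrite invrK; lra.
Qed.

(** Bernoulli's inequality at z^2, whose mean is 1. *)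
Lemma gmean_even_ge1 (n : nat) : 1 <= gmean (fun z => z ^+ (2 * n.+1)).
Proof.
have h (z : R) : 1 + n.+1%:R * (z ^+ 2 - 1) <= z ^+ (2 * n.+1).
  rewrite exprM; move: (z ^+ 2) (sqr_ge0 z) => u u0.
  elim: n => [|n IH]; first by rewrite mul1r expr1; lra.
  rewrite exprS; apply: (@le_trans _ _ (u * (1 + n.+1%:R * (u - 1)))).
    rewrite -(natr1 n.+1) -[n.+1%:R]/(n.+1%:R).
    have := ler0n R n.+1; move: (n.+1%:R : R) => N N0.
    have := mulr_ge0 N0 (sqr_ge0 (u - 1)); lra.
  by rewrite ler_wpM2l.
have -> : 1 = gmean (fun z : R => 1 + n.+1%:R * (z ^+ 2 - 1)).
  have l2 : polylip (fun z : R => z ^+ 2) by exact: polylip_Xn.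
  have l1 : polylip (fun _ : R => 1 : R) by exact: polylip_cst.
  have l21 := polylipB l2 l1.
  by rewrite (gmeanD l1 (polylipZ _ l21)) (gmeanZ _ l21) (gmeanB l2 l1)
    gmean_sqr gmean_cst subrr mulr0 addr0.
apply: le_gmean h.
  apply: polylipD; first exact: polylip_cst.
  by apply: polylipZ; apply: polylipB; [exact: polylip_Xn|exact: polylip_cst].
exact: polylip_Xn.
Qed.

End gaussian_mean.

(** * Gaussian vectors *)

Section gaussian_vector.
Variable R : realType.
Variable V : normedModType R.
Implicit Types (F G : V -> R) (es : seq V) (e x y w : V).

(** The mean of F(z_1 e_1 + ... + z_n e_n) for independent standard normal
    z_i. The recursion integrates one coordinate at a time, so that no
    measure on the space V is involved, and every property follows from the
    one-dimensional one by induction on the frame. *)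
Fixpoint vmean es F : R :=
  if es is e :: es' then vmean es' (fun x => gmean (fun z => F (x + z *: e)))
  else F 0.

(** The mean only sees the span of the frame: P is any property that holds
    along it, such as orthogonality to a further vector. *)
Lemma vmean_ext (P : V -> Prop) es F G : P 0 ->
  (forall e, e \in es -> forall x z, P x -> P (x + z *: e)) ->
  (forall x, P x -> F x = G x) -> vmean es F = vmean es G.
Proof.
elim: es F G => [|e es IH] F G P0 Pe FG /=; first exact: FG.
apply: IH => // [e' e'es|x Px].
  by apply: Pe; rewrite inE e'es orbT.
by apply: eq_gmean => z; apply: FG; apply: Pe => //; rewrite inE eqxx.
Qed.

Lemma eq_vmean es F G : F =1 G -> vmean es F = vmean es G.
Proof. by move=> /funext ->. Qed.

Lemma vmean_cst es (c : R) : vmean es (fun=> c) = c.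
Proof. by elim: es => //= e es IH; under eq_fun do rewrite gmean_cst. Qed.

Lemma vmeanD es F G : polylip F -> polylip G ->
  vmean es (fun x => F x + G x) = vmean es F + vmean es G.
Proof.
elim: es F G => //= e es IH F G lF lG.
rewrite -IH; [|exact: polylip_gmean..]; apply: eq_vmean => x.
by rewrite gmeanD//; exact: polylip_line.
Qed.

Lemma vmeanZ es c F : polylip F -> vmean es (fun x => c * F x) = c * vmean es F.
Proof.
elim: es F => //= e es IH F lF.
rewrite -IH; [|exact: polylip_gmean]; apply: eq_vmean => x.
by rewrite gmeanZ//; exact: polylip_line.
Qed.

Lemma vmeanB es F G : polylip F -> polylip G ->
  vmean es (fun x => F x - G x) = vmean es F - vmean es G.
Proof.
move=> lF lG; rewrite -[- vmean es G]mulN1r -vmeanZ// -vmeanD//.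
  by apply: eq_vmean => x; rewrite mulN1r.
exact: polylipZ.
Qed.

Lemma le_vmean es F G : polylip F -> polylip G -> (forall x, F x <= G x) ->
  vmean es F <= vmean es G.
Proof.
elim: es F G => //= e es IH F G lF lG FG; apply: IH => [||x].
- exact: polylip_gmean.
- exact: polylip_gmean.
- by apply: le_gmean => //; exact: polylip_line.
Qed.

Lemma vmeanN es F : polylip F -> vmean es (fun x => F (- x)) = vmean es F.
Proof.
elim: es F => [F _|e es IH F lF] /=; first by rewrite oppr0.
rewrite -[RHS]IH; last exact: polylip_gmean.
apply: eq_vmean => x; rewrite -[RHS]gmeanN; last exact: polylip_line.
by apply: eq_gmean => z; rewrite opprD scaleNr.
Qed.

Lemma polylip_vmean es F (s : R) : polylip F ->
  polylip (fun w => vmean es (fun x => F (w + s *: x))).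
Proof.
elim: es F => [F lF|e es IH F lF] /=.
  by under eq_fun do rewrite scaler0 addr0.
have := IH _ (polylip_gmean (s *: e) lF); congr polylip; apply/funext => w.
apply: eq_vmean => x; apply: eq_gmean => z.
by rewrite scalerDr addrA !scalerA [s * z]mulrC.
Qed.

Lemma gmean_vmean_swap es F w e (t : R) : polylip F ->
  gmean (fun z => vmean es (fun x => F (w + z *: e + t *: x))) =
  vmean es (fun x => gmean (fun z => F (w + z *: e + t *: x))).
Proof.
elim: es F => [//|e' es IH F lF] /=.
transitivity (gmean (fun z => vmean es (fun x =>
    gmean (fun z' => F (w + z *: e + t *: x + z' *: (t *: e')))))).
  apply: eq_gmean => z; apply: eq_vmean => x; apply: eq_gmean => z'.
  by rewrite scalerDr addrA !scalerA [t * z']mulrC.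
rewrite (IH (fun v => gmean (fun z' => F (v + z' *: (t *: e')))));
  last exact: polylip_gmean.
apply: eq_vmean => x.
transitivity (gmean (fun z => gmean (fun z' =>
    F (w + t *: x + z *: e + z' *: (t *: e'))))).
  by apply: eq_gmean => z; apply: eq_gmean => z'; rewrite (addrAC w).
rewrite (gmean_swap (w + t *: x) e (t *: e') lF).
apply: eq_gmean => z'; apply: eq_gmean => z.
by rewrite scalerDr !scalerA [t * z']mulrC !addrA (addrAC w).
Qed.

(** A Gaussian step of size s followed by an independent one of size t is a
    Gaussian step of size sqrt (s^2 + t^2), coordinate by coordinate. *)
Lemma vmean_conv es F (s t : R) : 0 <= s -> 0 < t -> polylip F ->
  vmean es (fun y => vmean es (fun x => F (s *: y + t *: x))) =
  vmean es (fun x => F (Num.sqrt (s ^+ 2 + t ^+ 2) *: x)).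
Proof.
move=> s0 t0; set r := Num.sqrt _.
elim: es F => [F _|e es IH F lF] /=; first by rewrite !scaler0 addr0.
pose F' v := gmean (fun z => F (v + z *: (r *: e))).
have lF' : polylip F' by exact: polylip_gmean.
transitivity (vmean es (fun x => F' (r *: x))); last first.
  apply: eq_vmean => x; apply: eq_gmean => z.
  by rewrite scalerDr !scalerA [r * z]mulrC.
rewrite -IH//; apply: eq_vmean => y.
transitivity (gmean (fun z => vmean es (fun x =>
    gmean (fun z' => F (s *: y + z *: (s *: e) + t *: x + z' *: (t *: e)))))).
  apply: eq_gmean => z; apply: eq_vmean => x; apply: eq_gmean => z'.
  by rewrite !scalerDr !scalerA [t * z']mulrC [s * z]mulrC !addrA.
rewrite (gmean_vmean_swap es (F := fun v => gmean (fun z' => F (v + z' *: (t *: e)))));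
  last exact: polylip_gmean.
apply: eq_vmean => x.
pose f (u : R) := F (s *: y + t *: x + u *: e).
transitivity (gmean (fun z => gmean (fun z' => f (s * z + t * z')))).
  apply: eq_gmean => z; apply: eq_gmean => z'.
  rewrite /f scalerDl !scalerA [z * s]mulrC [z' * t]mulrC !addrA.
  by rewrite (addrAC (s *: y)).
rewrite (gmean_conv s0 t0 (polylip_line (s *: y + t *: x) e lF)).
by apply: eq_gmean => z; rewrite scalerA mulrC.
Qed.

End gaussian_vector.

Section orthonormal.
Variables (R : realType) (r : nat).
Notation V := 'rV[R]_r.
Implicit Types (x y w e : V) (es : seq V).

Definition dot x y : R := \sum_j x 0 j * y 0 j.

Lemma dotC x y : dot x y = dot y x.
Proof. by apply: eq_bigr => j _; rewrite mulrC. Qed.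

Lemma dotDr w x y : dot w (x + y) = dot w x + dot w y.
Proof. by rewrite -big_split; apply: eq_bigr => j _; rewrite mxE mulrDr. Qed.

Lemma dotZr w z x : dot w (z *: x) = z * dot w x.
Proof. by rewrite mulr_sumr; apply: eq_bigr => j _; rewrite mxE mulrCA. Qed.

Lemma dotDl w x y : dot (x + y) w = dot x w + dot y w.
Proof. by rewrite !(dotC _ w) dotDr. Qed.

Lemma dotZl w z x : dot (z *: x) w = z * dot x w.
Proof. by rewrite !(dotC _ w) dotZr. Qed.

Lemma dot0r w : dot w 0 = 0.
Proof. by rewrite -(scale0r w) dotZr mul0r. Qed.

Lemma dotNr w x : dot w (- x) = - dot w x.
Proof. by rewrite -scaleN1r dotZr mulN1r. Qed.

Notation sq x := (dot x x).

Lemma sq_ge0 x : 0 <= sq x.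
Proof. by apply: sumr_ge0 => j _; rewrite -expr2 sqr_ge0. Qed.

Lemma sqD x y : sq (x + y) = sq x + 2 * dot x y + sq y.
Proof. by rewrite dotDr !dotDl (dotC y x); ring. Qed.

Lemma sqZ z x : sq (z *: x) = z ^+ 2 * sq x.
Proof. by rewrite dotZr dotZl mulrA expr2. Qed.

(** The discriminant of the nonnegative quadratic |x + z y|^2 in z. *)
Lemma dot_sqr_le x y : dot x y ^+ 2 <= sq x * sq y.
Proof.
have H z : 0 <= sq x + 2 * z * dot x y + z ^+ 2 * sq y.
  by have := sq_ge0 (x + z *: y); rewrite sqD dotZr sqZ; lra.
have := sq_ge0 y; rewrite le_eqVlt => /predU1P[y0|y0].
  rewrite -y0 mulr0; have [->|b0] := eqVneq (dot x y) 0; first by rewrite expr0n.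
  have := H (- (sq x + 1) / (2 * dot x y)); rewrite -y0 mulr0 addr0.
  by rewrite (_ : 2 * _ * _ = - (sq x + 1)); [lra|field].
have := H (- dot x y / sq y).
rewrite (_ : _ + _ = (sq x * sq y - dot x y ^+ 2) / sq y); last first.
  by field; rewrite gt_eqF.
by rewrite pmulr_lge0 ?invr_gt0// subr_ge0.
Qed.

Lemma polylip_dotr w : polylip (dot w).
Proof.
exists (\sum_j `|w 0 j|), 0%N => x y; rewrite expr0 mulr1.
rewrite (_ : dot w x - dot w y = dot w (x - y)); last by rewrite dotDr dotNr.
rewrite mulr_suml (le_trans (ler_norm_sum _ _ _))// ler_sum// => j _.
rewrite normrM ler_wpM2l// [leRHS]mx_normrE.
exact: (@le_bigmax _ _ _ _ (fun ij => `|(x - y) ij.1 ij.2|) (0, j)).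
Qed.

Lemma polylip_coord j : polylip (fun x : V => x 0 j).
Proof.
have := polylip_dotr (delta_mx 0 j); congr polylip; apply/funext => x.
rewrite /dot (bigD1 j)//= mxE !eqxx mul1r big1 ?addr0// => i ij.
by rewrite mxE eqxx (negbTE ij) mul0r.
Qed.

Lemma polylip_sq : polylip (fun x => sq x).
Proof.
by apply: polylip_sum => j; apply: polylipM; exact: polylip_coord.
Qed.

Lemma polylip_sqD : polylip (fun p : V * R => sq p.1 + p.2 ^+ 2).
Proof.
apply: polylipD.
  apply: (@polylip_comp _ _ _ (fun x => sq x) (fun p : V * R => p.1) 1) => //.
    exact: polylip_sq.
  by move=> p q; rewrite mul1r prod_normE le_max lexx.
apply: polylipX.
apply: (@polylip_comp _ _ _ (fun z : R => z) (fun p : V * R => p.2) 1) => //.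
  exact: polylip_id.
by move=> p q; rewrite mul1r prod_normE le_max lexx orbT.
Qed.

(** Obtained from [polylip_gmean] on the space V * R in the direction of the
    second factor, as z^2 is not a linear increment of |x|^2 inside V. *)
Lemma polylip_gmean_sq (phi : R -> R) :
  polylip (fun p : V * R => phi (sq p.1 + p.2 ^+ 2)) ->
  polylip (fun x : V => gmean (fun z => phi (sq x + z ^+ 2))).
Proof.
move=> lF; have lG := polylip_gmean ((0 : V), (1 : R)) lF.
rewrite (_ : (fun _ => _) = (fun p : V * R => gmean (fun z => phi
    (sq (p + z *: ((0 : V), (1 : R))).1 + (p + z *: ((0 : V), (1 : R))).2 ^+ 2)))
    \o (fun x : V => (x, 0 : R))).
  apply: (@polylip_comp _ _ _ _ (fun x : V => (x, 0 : R)) 1 ler01 lG) => x y.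
  by rewrite mul1r prod_normE/= subrr normr0 ge_max lexx/=.
apply/funext => x; apply: eq_gmean => z /=.
by rewrite scaler0 addr0 add0r [z *: _]mulr1.
Qed.

(** Stated recursively, in the shape needed for the induction on the frame
    that defines [vmean]. *)
Fixpoint orthonormal es : Prop :=
  if es is e :: es' then
    [/\ sq e = 1, forall e', e' \in es' -> dot e e' = 0 & orthonormal es']
  else True.

Lemma gmean_quad (a b c : R) :
  gmean (fun z => a + b * z + c * z ^+ 2) = a + c.
Proof.
rewrite !gmeanD ?gmeanZ ?gmean_cst ?gmean_id ?gmean_sqr ?mulr0 ?addr0 ?mulr1//;
  repeat first [exact: polylip_cst|exact: polylip_id|exact: polylip_Xn
               |apply: polylipD|apply: polylipZ].
Qed.

Lemma vmean_dot_sqr es w :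
  vmean es (fun x => dot w x ^+ 2) = \sum_(e <- es) dot w e ^+ 2.
Proof.
suff H (c : R) : vmean es (fun x => dot w x ^+ 2 + c) =
    \sum_(e <- es) dot w e ^+ 2 + c.
  by have := H 0; rewrite addr0 => <-; apply: eq_vmean => x; rewrite addr0.
elim: es c => [|e es IH] c /=; first by rewrite dot0r expr0n big_nil.
rewrite big_cons [_ + \sum_(_ <- _) _]addrC -addrA -IH; apply: eq_vmean => x.
transitivity (gmean (fun z => (dot w x ^+ 2 + c) + (2 * dot w x * dot w e) * z +
   dot w e ^+ 2 * z ^+ 2)).
  by apply: eq_gmean => z; rewrite dotDr dotZr; ring.
by rewrite gmean_quad; ring.
Qed.

Lemma vmean_sq es : orthonormal es ->
  vmean es (fun x => sq x) = (size es)%:R.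
Proof.
suff H (c : R) : orthonormal es ->
    vmean es (fun x => sq x + c) = (size es)%:R + c.
  by move=> /(H 0); rewrite addr0 => <-; apply: eq_vmean => x; rewrite addr0.
elim: es c => [|e es IH] c /=; first by rewrite dot0r.
move=> [e1 _ oes]; rewrite -natr1 -addrA -IH//; apply: eq_vmean => x.
transitivity (gmean (fun z => (sq x + c) + (2 * dot x e) * z + 1 * z ^+ 2)).
  by apply: eq_gmean => z; rewrite sqD dotZr sqZ e1; ring.
by rewrite gmean_quad; ring.
Qed.

(** A new coordinate, orthogonal to the earlier ones, adds z^2 to |x|^2.
    This is the recursion by which the chi-square laws are defined. *)
Lemma vmean_radial e es (phi : R -> R) : orthonormal (e :: es) ->
  vmean (e :: es) (fun x => phi (sq x)) =
  vmean es (fun x => gmean (fun z => phi (sq x + z ^+ 2))).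
Proof.
move=> /= [e1 oe _]; apply: (@vmean_ext _ _ (fun x => dot e x = 0)).
- exact: dot0r.
- by move=> e' /oe e'0 x z ex; rewrite dotDr dotZr ex e'0 mulr0 addr0.
- move=> x ex; apply: eq_gmean => z.
  by rewrite sqD dotZr sqZ (dotC x) ex e1 !mulr0 addr0 mulr1.
Qed.

(** Convexity of the square: u + v is the mean of (k+1) u/k and (k+1) v with
    weights k/(k+1) and 1/(k+1). *)
Lemma sqrD_weighted (k u v : R) : 0 < k ->
  k * (u + v) ^+ 2 <= (k + 1) * (u ^+ 2 + k * v ^+ 2).
Proof. by move=> k0; have := sqr_ge0 (u - k * v); nra. Qed.

Lemma X4D_weighted (k u v : R) : 0 < k ->
  k ^+ 3 * (u + v) ^+ 4 <= (k + 1) ^+ 3 * (u ^+ 4 + k ^+ 3 * v ^+ 4).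
Proof.
move=> k0; have h := sqrD_weighted u v k0.
have h2 := sqrD_weighted (u ^+ 2) (k * v ^+ 2) k0.
have : (k * (u + v) ^+ 2) ^+ 2 <= ((k + 1) * (u ^+ 2 + k * v ^+ 2)) ^+ 2.
  have h0 : 0 <= k * (u + v) ^+ 2 by rewrite mulr_ge0 ?sqr_ge0// ltW.
  by rewrite lerXn2r// nnegrE// (le_trans h0 h).
move=> /(ler_wpM2l (ltW k0)) h3.
have h4 := ler_wpM2l (sqr_ge0 (k + 1)) h2.
rewrite (_ : k ^+ 3 * _ = k * (k * (u + v) ^+ 2) ^+ 2); last by ring.
apply: (le_trans h3).
rewrite (_ : (k + 1) ^+ 3 * _ = (k + 1) ^+ 2 * ((k + 1) *
  ((u ^+ 2) ^+ 2 + k * (k * v ^+ 2) ^+ 2))); last by ring.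
by apply: le_trans h4; rewrite exprMn mulrCA.
Qed.

(** By induction on the number of coordinates. The weighted convexity
    inequality for the power n + 1, with k equal to the number of
    coordinates already present, turns M k^(n+1) and M into M (k+1)^(n+1). *)
Lemma vmean_sqX n (M : R) es :
  (forall k u v : R, 0 < k ->
    k ^+ n * (u + v) ^+ n.+1 <= (k + 1) ^+ n * (u ^+ n.+1 + k ^+ n * v ^+ n.+1)) ->
  gmean (fun z => z ^+ (2 * n.+1)) <= M -> orthonormal es ->
  vmean es (fun x => sq x ^+ n.+1) <= M * (size es)%:R ^+ n.+1.
Proof.
move=> wt zM; elim: es => [|e es IH]; first by rewrite /= dot0r expr0n mulr0.
move=> oees; rewrite (vmean_radial (fun u => u ^+ n.+1))//.
case: oees => _ _ oes; have {IH} := IH oes; rewrite [size (_ :: _)]/=.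
have [->|esN0] := eqVneq es [::].
  rewrite /= dot0r expr0n expr1n mulr1 => _; apply: le_trans zM.
  by rewrite le_eqVlt; apply/orP; left; apply/eqP/eq_gmean => z;
    rewrite add0r exprM.
(* The weight k must be positive, whence the separate case of one
   coordinate. *)
have k0 : 0 < (size es)%:R :> R by rewrite ltr0n lt0n size_eq0.
rewrite -natr1; set k : R := (size es)%:R in k0 *; move=> IH.
have kn0 : 0 < k ^+ n by rewrite exprn_gt0.
pose A := (k + 1) ^+ n / k ^+ n; pose B := (k + 1) ^+ n.
have A0 : 0 <= A by rewrite divr_ge0// exprn_ge0//; lra.
have B0 : 0 <= B by rewrite exprn_ge0//; lra.
have lsq := polylipX n.+1 polylip_sq.
have le1 : vmean es (fun x => gmean (fun z => (sq x + z ^+ 2) ^+ n.+1)) <=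
    vmean es (fun x => A * sq x ^+ n.+1 + B * M).
  have lG : polylip (fun x => gmean (fun z => (sq x + z ^+ 2) ^+ n.+1)).
    apply: (polylip_gmean_sq (phi := fun u => u ^+ n.+1)); apply: polylipX.
    exact: polylip_sqD.
  apply: le_vmean => //.
    by apply: polylipD; [exact: polylipZ|exact: polylip_cst].
  move=> x.
  have lz : polylip (fun z : R => (sq x + z ^+ 2) ^+ n.+1).
    by apply/polylipX/polylipD; [exact: polylip_cst|exact: polylip_Xn].
  apply: (@le_trans _ _ (gmean (fun z => A * sq x ^+ n.+1 +
      B * z ^+ (2 * n.+1)))).
    apply: le_gmean => // [|z].
      by apply: polylipD; [exact: polylip_cst|apply: polylipZ; exact: polylip_Xn].
    have := wt _ (sq x) (z ^+ 2) k0; rewrite -ler_pdivlMl// => /le_trans; apply.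
    rewrite le_eqVlt; apply/orP; left; apply/eqP; rewrite -exprM /A /B.
    by field; rewrite gt_eqF.
  have lX : polylip (fun z : R => z ^+ (2 * n.+1)) by exact: polylip_Xn.
  rewrite (gmeanD (polylip_cst _ _) (polylipZ B lX)) gmean_cst (gmeanZ _ lX).
  by rewrite lerD2l ler_wpM2l.
apply: (le_trans le1).
rewrite (vmeanD es (polylipZ A lsq) (polylip_cst _ _)) (vmeanZ es A lsq) vmean_cst.
apply: (@le_trans _ _ (A * (M * k ^+ n.+1) + B * M)).
  by rewrite lerD2r ler_wpM2l.
rewrite le_eqVlt; apply/orP; left; apply/eqP; rewrite /A /B !exprS.
by field; rewrite gt_eqF.
Qed.

End orthonormal.

(** * Taylor expansion on the half-line *)

Section taylor_halfline.
Variable R : realType.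
Implicit Types (g h : R -> R) (x y q d t : R).

Lemma derivable_Rplus_dist g x : derivable_Rplus g x -> forall e : R, 0 < e ->
  exists2 d : R, 0 < d & forall y, 0 <= y -> y != x -> `|y - x| < d ->
    `|(g y - g x) / (y - x) - derive_Rplus g x| < e.
Proof.
move=> dg e e0; have /cvgrPdist_lt /(_ e e0) := dg.
rewrite /within /= /dnbhs.
move=> /nbhs_ballP[d /= d0 xd]; exists d => // y y0 yx yd.
rewrite distrC; apply: xd => //=.
  by rewrite -ball_normE /ball_/= distrC.
by rewrite in_itv/= y0.
Qed.

(** A local bound of the increments suffices for continuity, at 0 as well. *)
Lemma derivable_Rplus_lipschitz g x : derivable_Rplus g x ->
  exists K, exists2 d : R, 0 < d & forall y, 0 <= y -> `|y - x| < d ->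
    `|g y - g x| <= K * `|y - x|.
Proof.
move=> /derivable_Rplus_dist /(_ 1 ltr01)[d d0 H].
exists (`|derive_Rplus g x| + 1), d => // y y0 yd.
have [->|yx] := eqVneq y x; first by rewrite !subrr normr0 mulr0.
have yx0 : y - x != 0 by rewrite subr_eq0.
have := H y y0 yx yd; set Q := _ / _; set L := derive_Rplus g x => QL.
have -> : g y - g x = Q * (y - x) by rewrite /Q divfK.
rewrite normrM ler_wpM2r// -[Q](subrK L) (le_trans (ler_normD _ _))//.
by rewrite addrC lerD2l ltW.
Qed.

(** Extends a function on the half-line to a continuous one on the whole
    line, so that the calculus of two-sided limits applies to it. It stays
    differentiable at all points except possibly 0. *)
Definition clip0 g y := g (Num.max 0 y).

Lemma clip0E g y : 0 <= y -> clip0 g y = g y.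
Proof. by move=> y0; rewrite /clip0 max_r. Qed.

Lemma clip0_lip x y : `|Num.max 0 x - Num.max 0 y| <= `|x - y|.
Proof.
have h1 := ler_norm (x - y); have h2 := ler_norm (y - x).
rewrite distrC in h2; rewrite ler_norml /Num.max.
by case: ltP => ?; case: ltP => ?; apply/andP; split; lra.
Qed.

Lemma continuous_clip0 g : (forall x, 0 <= x -> derivable_Rplus g x) ->
  continuous (clip0 g).
Proof.
move=> dg x; set x' := Num.max 0 x.
have x'0 : 0 <= x' by rewrite le_max lexx.
have [K [d d0 H]] := derivable_Rplus_lipschitz (dg _ x'0).
have K0 : 0 <= `|K| by [].
apply/cvgrPdist_le => /= e e0.
have K1 : 0 < `|K| + 1 by lra.
near=> y.
have yd : `|x - y| < d by near: y; apply: cvgr_dist_lt d0; exact: cvg_id.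
have ye : `|x - y| < e / (`|K| + 1).
  by near: y; apply: cvgr_dist_lt; rewrite ?divr_gt0//; exact: cvg_id.
have mx : `|Num.max 0 y - x'| <= `|x - y|.
  by rewrite distrC clip0_lip.
rewrite distrC (le_trans (H _ _ _))//.
- by rewrite le_max lexx.
- exact: le_lt_trans yd.
move: ye; rewrite ltr_pdivlMr// => /ltW; apply: le_trans.
rewrite mulrDr mulr1 (@le_trans _ _ (`|x - y| * `|K|))// ?lerDl//.
apply: (@le_trans _ _ (`|K| * `|Num.max 0 y - x'|)).
  by rewrite ler_wpM2r// ler_norm.
by rewrite [leRHS]mulrC ler_wpM2l.
Unshelve. all: by end_near. Qed.

Lemma is_derive_clip0 g x : 0 < x -> derivable_Rplus g x ->
  is_derive x 1 (clip0 g) (derive_Rplus g x).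
Proof.
move=> x0 dg.
suff H : (fun t : R => t^-1 *: (clip0 g (t *: 1 + x) - clip0 g x)) @ 0^' -->
    derive_Rplus g x.
  apply: DeriveDef; first by apply/cvg_ex; exists (derive_Rplus g x).
  exact: cvg_lim H.
apply/cvgrPdist_lt => /= e e0.
have [d d0 H] := derivable_Rplus_dist dg e0.
near=> t.
have t0 : t != 0 by near: t; exact: nbhs_dnbhs_neq.
have td : `|t| < Num.min d x.
  near: t; apply: dnbhs0_lt; rewrite lt_min d0; exact: x0.
move: td; rewrite lt_min => /andP[td tx].
have tx0 : 0 <= t + x.
  by move: tx; rewrite ltr_norml => /andP[]; lra.
rewrite [t *: 1]mulr1 !clip0E// ?ltW// distrC.
have := H (t + x) tx0; rewrite addrK mulrC; apply => //.
by rewrite -subr_eq0 addrK.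
Unshelve. all: by end_near. Qed.

(** The mean value theorem for phi u - M u^(m+1) / (m+1): one integration
    step of the remainder in Taylor's formula. *)
Lemma le_pow_of_derive (phi dphi : R -> R) (M : R) (m : nat) :
  (forall t, 0 < t < 1 -> is_derive t 1 phi (dphi t)) -> continuous phi ->
  phi 0 = 0 -> (forall t, 0 < t < 1 -> dphi t <= M * t ^+ m) ->
  forall t, 0 <= t <= 1 -> phi t <= M / m.+1%:R * t ^+ m.+1.
Proof.
move=> dp cp p0 pM t /andP[]; rewrite le_eqVlt => /predU1P[<- _|t0 t1].
  by rewrite p0 expr0n mulr0.
pose F u := phi u - M / m.+1%:R * u ^+ m.+1.
have dF u : u \in `]0, t[ -> is_derive u 1 F (dphi u - M * u ^+ m).
  rewrite in_itv/= => /andP[u0 ut].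
  have u1 : 0 < u < 1 by rewrite u0 (lt_le_trans ut).
  have ? := dp u u1.
  have dX := is_deriveX m.+1 (is_derive_id u (1 : R)).
  rewrite (_ : F = phi - (M / m.+1%:R) *: (id ^+ m.+1 : R -> R)); last first.
    by apply/funext => v; rewrite /F !fctE; congr (_ - _).
  rewrite (_ : _ - _ = dphi u - (M / m.+1%:R) *: ((m.+1%:R * u ^+ m) *: 1)).
    by apply: is_deriveB.
  by rewrite /GRing.scale/= mulr1 mulrA divfK ?pnatr_eq0.
have cF : {within `[0, t], continuous F}.
  apply: continuous_subspaceT => u; apply: cvgB; first exact: cp.
  by apply: cvgM; [exact: cvg_cst|exact: exprn_continuous].
have [c] := MVT t0 dF cF.
rewrite in_itv/= => /andP[c0 ct].
rewrite {1 2}/F p0 expr0n mulr0 !subr0 => e.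
have := pM c; rewrite c0 (lt_le_trans ct t1) => /(_ isT) pc.
have : (dphi c - M * c ^+ m) * t <= 0.
  by apply: mulr_le0_ge0; [lra|exact: ltW].
by rewrite -e subr_le0.
Qed.

Lemma norm_le_pow_of_derive (phi dphi : R -> R) (M : R) (m : nat) :
  (forall t, 0 < t < 1 -> is_derive t 1 phi (dphi t)) -> continuous phi ->
  phi 0 = 0 -> (forall t, 0 < t < 1 -> `|dphi t| <= M * t ^+ m) ->
  forall t, 0 <= t <= 1 -> `|phi t| <= M / m.+1%:R * t ^+ m.+1.
Proof.
move=> dp cp p0 pM t t01; rewrite ler_norml lerNl; apply/andP; split.
  apply: (@le_pow_of_derive (fun u => - phi u) (fun u => - dphi u)) t01.
  - by move=> u u01; have ? := dp u u01; exact: is_deriveN.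
  - by move=> u; apply: cvgN; exact: cp.
  - by rewrite p0 oppr0.
  - by move=> u /pM; rewrite ler_norml lerNl => /andP[].
apply: (@le_pow_of_derive phi dphi) t01 => // u /pM.
by rewrite ler_norml => /andP[].
Qed.

Lemma is_derive_cubic (a b c e t : R) :
  is_derive t 1 (fun u : R => a + b * u + c * u ^+ 2 + e * u ^+ 3)
    (b + 2 * c * t + 3 * e * t ^+ 2).
Proof.
rewrite (_ : (fun u => _) = cst a + b *: (id : R -> R) +
    c *: (id ^+ 2 : R -> R) + e *: (id ^+ 3 : R -> R)); last first.
  by apply/funext => u; rewrite !fctE.
have d2 := is_deriveX 2 (is_derive_id t (1 : R)).
have d3 := is_deriveX 3 (is_derive_id t (1 : R)).
have H := is_deriveD (is_deriveD (is_deriveD (is_derive_cst a t (1 : R))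
  (is_deriveZ b (is_derive_id t (1 : R)))) (is_deriveZ c d2)) (is_deriveZ e d3).
rewrite (_ : b + 2 * c * t + 3 * e * t ^+ 2 = 0 + b *: (1 : R) +
  c *: ((2%:R * id t ^+ 2.-1) *: (1 : R)) +
  e *: ((3%:R * id t ^+ 3.-1) *: (1 : R))); first exact: H.
by rewrite /GRing.scale/=; ring.
Qed.

Lemma continuous_cubic (a b c e : R) :
  continuous (fun u : R => a + b * u + c * u ^+ 2 + e * u ^+ 3).
Proof.
move=> t; have [+ _] := is_derive_cubic a b c e t.
by move=> /derivable1_diffP/differentiable_continuous.
Qed.

Section smooth.
Variables (h : R -> R) (M1 M2 M3 M4 : R).
Hypothesis hh : forall j, (j < 4)%N -> forall x, 0 <= x ->
  derivable_Rplus (deriven_Rplus j h) x.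
Notation h_ j := (deriven_Rplus j h).
Hypothesis hM4 : forall x, 0 <= x -> `|h_ 4 x| <= M4.
Hypothesis hM1 : forall x, 0 <= x -> `|h_ 1 x| <= M1.

(* The open segment avoids 0, the one point where only a one-sided
   derivative exists, unless it is reduced to a point. *)
Let segment q d t : 0 <= q -> 0 <= q + d -> 0 < t < 1 ->
  d = 0 \/ 0 < q + t * d.
Proof.
move=> q0 qd0 /andP[t0 t1]; have [->|dN0] := eqVneq d 0; [by left|right].
have [d0|d0] := ltP 0 d; first by have := mulr_gt0 t0 d0; lra.
have d1 : d < 0 by rewrite lt_neqAle dN0.
have : 0 < (1 - t) * - d by rewrite mulr_gt0//; lra.
lra.
Qed.

Lemma is_derive_line j q d t : (j < 4)%N -> 0 <= q -> 0 <= q + d ->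
  0 < t < 1 ->
  is_derive t 1 (fun u => clip0 (h_ j) (q + u * d)) (d * h_ j.+1 (q + t * d)).
Proof.
move=> j4 q0 qd0 t01; have [->|qt] := segment q0 qd0 t01.
  rewrite mul0r (_ : (fun u => _) = cst (clip0 (h_ j) q)).
    exact: is_derive_cst.
  by apply/funext => u; rewrite mulr0 addr0.
have dl : is_derive t 1 (fun u : R => q + u * d) d.
  rewrite (_ : (fun u => _) = cst q + d *: (id : R -> R)).
    rewrite [X in is_derive _ _ _ X](_ : d = 0 + d *: 1).
      by apply: is_deriveD.
    by rewrite add0r [_ *: _]mulr1.
  by apply/funext => u; rewrite !fctE mulrC.
rewrite mulrC.
apply: (is_derive1_comp (f := clip0 (h_ j)) (g := fun u => q + u * d)) => //.
by apply: is_derive_clip0 => //; apply: hh => //; exact: ltW.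
Qed.

Lemma continuous_line j q d : (j < 4)%N ->
  continuous (fun u : R => clip0 (h_ j) (q + u * d)).
Proof.
move=> j4 t; apply: (@continuous_comp _ _ _ (fun u : R => q + u * d) (clip0 (h_ j))).
  by apply: cvgD; [exact: cvg_cst|apply: cvgM; [exact: cvg_id|exact: cvg_cst]].
by apply: continuous_clip0 => x x0; exact: hh.
Qed.

(** One step of Taylor's formula along the segment from q to q + d: an
    estimate for the derivative of order j + 1 gives one for the derivative
    of order j. The comparison polynomial is a cubic, which covers j = 0,
    ..., 3 at once. *)
Lemma line_remainder j q d (a b c e M : R) (m : nat) : (j < 4)%N ->
  0 <= q -> 0 <= q + d ->
  clip0 (h_ j) q = a + b * 0 + c * 0 ^+ 2 + e * 0 ^+ 3 ->
  (forall t, 0 <= t -> t <= 1 -> 0 <= q + t * d ->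
    `|d * h_ j.+1 (q + t * d) - (b + 2 * c * t + 3 * e * t ^+ 2)| <= M * t ^+ m) ->
  forall t, 0 <= t <= 1 ->
  `|clip0 (h_ j) (q + t * d) - (a + b * t + c * t ^+ 2 + e * t ^+ 3)| <=
    M / m.+1%:R * t ^+ m.+1.
Proof.
move=> j4 q0 qd0 p0 dM.
apply: (@norm_le_pow_of_derive
  (fun t => clip0 (h_ j) (q + t * d) - (a + b * t + c * t ^+ 2 + e * t ^+ 3))
  (fun t => d * h_ j.+1 (q + t * d) - (b + 2 * c * t + 3 * e * t ^+ 2))).
- move=> t t01; have dl := is_derive_line j4 q0 qd0 t01.
  have dc := is_derive_cubic a b c e t.
  exact: is_deriveB.
- by move=> t; apply: cvgB; [exact: continuous_line|exact: continuous_cubic].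
- by rewrite mul0r addr0 p0 subrr.
- move=> t t01; have [t0 t1] := andP t01; apply: dM; [exact: ltW|exact: ltW|].
  have [->|/ltW//] := segment q0 qd0 t01.
  by rewrite mulr0 addr0.
Qed.

Lemma lipschitz_Rplus x y : 0 <= x -> 0 <= y -> `|h x - h y| <= M1 * `|x - y|.
Proof.
move=> x0 y0.
have xy0 : 0 <= y + (x - y) by rewrite addrC subrK.
have p0 : clip0 h y = h y + 0 * 0 + 0 * 0 ^+ 2 + 0 * 0 ^+ 3.
  by rewrite clip0E// !mul0r !addr0.
have dM t : 0 <= t -> t <= 1 -> 0 <= y + t * (x - y) ->
    `|(x - y) * h_ 1 (y + t * (x - y)) - (0 + 2 * 0 * t + 3 * 0 * t ^+ 2)| <=
    M1 * `|x - y| * t ^+ 0.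
  move=> t0 t1 yt.
  rewrite expr0 mulr1 !mulr0 !mul0r !addr0 subr0 normrM mulrC ler_wpM2r//.
  exact: hM1.
have := line_remainder (j := 0) isT y0 xy0 p0 dM (t := 1).
rewrite ler01 lexx => /(_ isT).
by rewrite !mul0r !addr0 mul1r (addrC y) subrK clip0E// expr1n divr1 mulr1.
Qed.

Lemma taylor_Rplus q d : 0 <= q -> 0 <= q + d ->
  `|h (q + d) - (h q + h_ 1 q * d + h_ 2 q / 2 * d ^+ 2 + h_ 3 q / 6 * d ^+ 3)|
    <= M4 / 24 * d ^+ 4.
Proof.
move=> q0 qd0; set D := `|d|.
have D0 : 0 <= D by exact: normr_ge0.
have rem j a b c e M m (j4 : (j < 4)%N) :=
  @line_remainder j q d a b c e M m j4 q0 qd0.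
have r3 t : 0 <= t <= 1 -> `|clip0 (h_ 3) (q + t * d) - h_ 3 q| <= D * M4 * t.
  move=> t01; have := rem 3%N (h_ 3 q) 0 0 0 (D * M4) 0%N isT _ _ t t01.
  rewrite !mul0r !addr0 divr1 expr1; apply; first by rewrite clip0E.
  move=> u u0 u1 qu.
  by rewrite expr0 mulr1 !(mulr0, mul0r) !addr0 subr0 normrM ler_wpM2l// hM4.
have r2 t : 0 <= t <= 1 ->
    `|clip0 (h_ 2) (q + t * d) - (h_ 2 q + d * h_ 3 q * t)| <=
    D ^+ 2 * M4 / 2 * t ^+ 2.
  move=> t01.
  have := rem 2%N (h_ 2 q) (d * h_ 3 q) 0 0 (D ^+ 2 * M4) 1%N isT _ _ t t01.
  rewrite !mul0r !addr0; apply; first by rewrite clip0E// mulr0 addr0.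
  move=> u u0 u1 qu.
  rewrite !(mulr0, mul0r) !addr0 -mulrBr normrM expr1.
  have := r3 u; rewrite u0 u1 clip0E// => /(_ isT) h3.
  by rewrite expr2 -!mulrA ler_wpM2l// mulrA.
have r1 t : 0 <= t <= 1 ->
    `|clip0 (h_ 1) (q + t * d) -
      (h_ 1 q + d * h_ 2 q * t + d ^+ 2 * h_ 3 q / 2 * t ^+ 2)|
    <= D ^+ 3 * M4 / 6 * t ^+ 3.
  move=> t01.
  have := rem 1%N (h_ 1 q) (d * h_ 2 q) (d ^+ 2 * h_ 3 q / 2) 0
    (D ^+ 3 * M4 / 2) 2%N isT _ _ t t01.
  rewrite !mul0r !addr0 (_ : D ^+ 3 * M4 / 2 / 3 = D ^+ 3 * M4 / 6); last first.
    by field.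
  apply; first by rewrite clip0E// expr0n !mulr0 !addr0.
  move=> u u0 u1 qu.
  have := r2 u; rewrite u0 u1 clip0E// => /(_ isT) h2.
  rewrite (_ : _ - _ = d * (h_ 2 (q + u * d) - (h_ 2 q + d * h_ 3 q * u)));
    last by field.
  rewrite normrM (_ : D ^+ 3 * M4 / 2 * _ = D * (D ^+ 2 * M4 / 2 * u ^+ 2));
    last by field.
  by rewrite ler_wpM2l.
have := rem 0%N (h q) (d * h_ 1 q) (d ^+ 2 * h_ 2 q / 2) (d ^+ 3 * h_ 3 q / 6)
    (D ^+ 4 * M4 / 6) 3%N isT _ _ 1.
rewrite ler01 lexx mul1r (clip0E _ q0) (clip0E _ qd0) !expr1n !mulr1.
have D4 : d ^+ 4 = D ^+ 4.
  by rewrite -normrX ger0_norm// (exprM d 2 2) sqr_ge0.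
rewrite (_ : D ^+ 4 * M4 / 6 / 4 = M4 / 24 * d ^+ 4); last by rewrite D4; field.
move=> H.
rewrite (_ : h q + _ + _ + _ = h q + d * h_ 1 q + d ^+ 2 * h_ 2 q / 2 +
  d ^+ 3 * h_ 3 q / 6); last by field.
apply: H => //; first by rewrite !expr0n !mulr0 !addr0.
move=> u u0 u1 qu.
have := r1 u; rewrite u0 u1 clip0E// => /(_ isT) h1.
rewrite (_ : _ - _ = d * (h_ 1 (q + u * d) -
    (h_ 1 q + d * h_ 2 q * u + d ^+ 2 * h_ 3 q / 2 * u ^+ 2))); last by field.
rewrite normrM (_ : D ^+ 4 * M4 / 6 * _ = D * (D ^+ 3 * M4 / 6 * u ^+ 3));
  last by field.
by rewrite ler_wpM2l.
Qed.

Hypothesis hM2 : forall x, 0 <= x -> `|h_ 2 x| <= M2.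
Hypothesis hM3 : forall x, 0 <= x -> `|h_ 3 x| <= M3.

(** In the mean of Taylor's formula at d = 2 b + c and d = - 2 b + c, odd
    powers of b cancel. Since b^2 <= q c, every remaining term apart from c
    and b^2 contains c^2: d^2 contributes c^2, d^3 contributes c^3 + 12 b^2
    c and the remainder d^4 at most c^2 times a quadratic form in q and c.
    The coefficients are rounded up to those of the norm h_4. *)
Lemma taylor_sym q b c : 0 <= q -> 0 <= c -> b ^+ 2 <= q * c ->
  `|(h (q + 2 * b + c) + h (q - 2 * b + c)) / 2 -
    (h q + h_ 1 q * c + 2 * h_ 2 q * b ^+ 2)| <=
  (M1 + 7 * M2 + 6 * M3 + M4) * (c ^+ 2 * (1 + 2 * q ^+ 2 + c ^+ 2)).
Proof.
move=> q0 c0 bqc.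
(* Both points q + 2 s b + c, s = 1 or -1, are squared lengths, but here
   only b^2 <= q c is known: 2 |b| <= 2 sqrt (q c) <= q + c. *)
have pos (s : R) : s ^+ 2 <= 1 -> 0 <= q + (2 * s * b + c).
  move=> s1; suff : `|2 * s * b| <= q + c.
    by rewrite ler_norml => /andP[]; lra.
  rewrite -(@ler_pXn2r _ 2)// ?nnegrE ?addr_ge0// real_normK ?num_real//.
  have := sqr_ge0 (q - c); have := ler_pM (sqr_ge0 s) (sqr_ge0 b) s1 bqc.
  by rewrite mul1r; nra.
have p1 : 0 <= q + (2 * 1 * b + c) by apply: pos; rewrite expr1n.
have p2 : 0 <= q + (2 * -1 * b + c) by apply: pos; rewrite sqrrN expr1n.
have T1 := taylor_Rplus q0 p1; have T2 := taylor_Rplus q0 p2.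
have m1 := le_trans (normr_ge0 _) (hM1 q0).
have m2 := hM2 q0; have m3 := hM3 q0.
have m4 := le_trans (normr_ge0 _) (hM4 q0).
move: T1 T2; rewrite (_ : q + (2 * 1 * b + c) = q + 2 * b + c); last by ring.
rewrite (_ : q + (2 * -1 * b + c) = q - 2 * b + c); last by ring.
set a0 := h _ => T1; set a1 := h _ => T2.
move: m1 m2 m3 T1 T2; set h1 := h_ 1 q; set h2 := h_ 2 q; set h3 := h_ 3 q.
set h0 := h q => m1 m2 m3.
set t1 := _ + h3 / 6 * _ => T1; set t2 := _ + h3 / 6 * _ => T2.
have -> : (a0 + a1) / 2 - (h0 + h1 * c + 2 * h2 * b ^+ 2) =
    (a0 - t1) / 2 + (a1 - t2) / 2 + h2 * (c ^+ 2 / 2) +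
    h3 * ((c ^+ 3 + 12 * b ^+ 2 * c) / 6).
  by rewrite /t1 /t2; field.
have half x : `|x / 2| = `|x| / 2 by rewrite normrM [`|2^-1|]ger0_norm.
have c2 := sqr_ge0 c.
have e2 : 0 <= (c ^+ 3 + 12 * b ^+ 2 * c) / 6.
  apply: divr_ge0 => //; apply: addr_ge0; first exact: exprn_ge0.
  by apply: mulr_ge0 => //; apply: mulr_ge0 => //; exact: sqr_ge0.
rewrite (le_trans (ler_normD _ _))//.
rewrite (le_trans (lerD (ler_normD _ _) (lexx _)))//.
rewrite (le_trans (lerD (lerD (ler_normD _ _) (lexx _)) (lexx _)))//.
rewrite !half (normrM h2) (normrM h3) [`|c ^+ 2 / 2|]ger0_norm ?divr_ge0//.
rewrite [`|(_ + _) / 6|]ger0_norm//.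
set W := 1 + _ + _.
have W2 : c ^+ 2 / 2 <= 7 * (c ^+ 2 * W).
  by have := mulr_ge0 c2 c2; have := mulr_ge0 c2 (sqr_ge0 q); rewrite /W; nra.
have W3 : (c ^+ 3 + 12 * b ^+ 2 * c) / 6 <= 6 * (c ^+ 2 * W).
  apply: (@le_trans _ _ (c ^+ 2 * ((c + 12 * q) / 6))).
    by have := ler_wpM2r c0 bqc; nra.
  rewrite [leRHS]mulrCA ler_wpM2l// /W.
  by have := sqr_ge0 (c - 1); have := sqr_ge0 (q - 1); nra.
have W4 : ((2 * 1 * b + c) ^+ 4 + (2 * -1 * b + c) ^+ 4) / 48 <= c ^+ 2 * W.
  apply: (@le_trans _ _ (c ^+ 2 * ((c ^+ 2 + 24 * (q * c) + 16 * q ^+ 2) / 24))).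
    have := ler_pM (sqr_ge0 b) (sqr_ge0 b) bqc bqc.
    by have := ler_wpM2l c2 bqc; nra.
  rewrite ler_wpM2l// /W.
  by have := sqr_ge0 (c - q); have := sqr_ge0 q; nra.
have M2W := ler_pM (normr_ge0 h2) (divr_ge0 c2 (ler0n _ 2)) m2 W2.
have M3W := ler_pM (normr_ge0 h3) e2 m3 W3.
have M4W := ler_wpM2l m4 W4.
have M1W : 0 <= M1 * (c ^+ 2 * W).
  by rewrite !mulr_ge0// /W; have := sqr_ge0 q; lra.
lra.
Qed.

End smooth.

End taylor_halfline.

(** * The vectors of centred ranks *)

Section rank_vectors.
Variables (R : realType) (k : nat).
Hypothesis k0 : (0 < k)%N.
Notation r := k.+1.
Notation V := 'rV[R]_r.
Implicit Types (s : 'S_r) (w x : V) (i j l : 'I_r).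

Definition rank_score j : R :=
  Num.sqrt 12 / Num.sqrt (r%:R * (r%:R + 1)) * (j.+1%:R - (r%:R + 1) / 2).

Definition rank_vec s : V := \row_j rank_score (s j).

Definition perm_mean (F : V -> R) : R :=
  (#|{: 'S_r}|%:R)^-1 * \sum_(s : 'S_r) F (rank_vec s).

Lemma rank_score_rev j : rank_score (rev_ord j) = - rank_score j.
Proof.
rewrite /rank_score -[RHS]mulrN; congr (_ * _).
by rewrite /= subSS -!natr1 natrB; [field|rewrite -ltnS ltn_ord].
Qed.

Lemma sum_rank_score : \sum_j rank_score j = 0.
Proof.
have : \sum_j rank_score j = - \sum_j rank_score j.
  rewrite -sumrN (reindex_inj rev_ord_inj)/=.
  by apply: eq_bigr => j _; rewrite rank_score_rev.
by lra.
Qed.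

Lemma sum_sqr_centered (n : nat) (a : R) :
  \sum_(j < n) (j.+1%:R - a) ^+ 2 =
  n%:R * (n%:R + 1) * (2 * n%:R + 1) / 6 - a * n%:R * (n%:R + 1) + n%:R * a ^+ 2.
Proof.
elim: n => [|n IH]; first by rewrite big_ord0; ring.
by rewrite big_ord_recr/= IH -!natr1; field.
Qed.

Lemma sum_sqr_rank_score : \sum_j rank_score j ^+ 2 = k%:R.
Proof.
under eq_bigr do rewrite exprMn.
rewrite -mulr_sumr sum_sqr_centered expr_div_n !sqr_sqrtr//.
rewrite -natr1; field.
by have := ler0n R k => ?; apply/andP; split; rewrite gt_eqF//; lra.
Qed.

Lemma sum_rank_vec s : \sum_j rank_vec s 0 j = 0.
Proof.
rewrite -[RHS]sum_rank_score [RHS](reindex_inj (@perm_inj _ s))/=.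
by apply: eq_bigr => j _; rewrite mxE.
Qed.

Lemma sq_rank_vec s : dot (rank_vec s) (rank_vec s) = k%:R.
Proof.
rewrite -sum_sqr_rank_score [RHS](reindex_inj (@perm_inj _ s))/=.
by apply: eq_bigr => j _; rewrite mxE -expr2.
Qed.

Lemma card_perm_gt0 : 0 < #|{: 'S_r}|%:R :> R.
Proof. by rewrite ltr0n; apply/card_gt0P; exists 1%g. Qed.

Lemma perm_mean_cst (c : R) : perm_mean (fun=> c) = c.
Proof.
rewrite /perm_mean sumr_const -[c *+ _]mulr_natl mulrA mulVf ?mul1r//.
by rewrite gt_eqF// card_perm_gt0.
Qed.

Lemma perm_meanD F G : perm_mean (fun x => F x + G x) = perm_mean F + perm_mean G.
Proof. by rewrite /perm_mean big_split mulrDr. Qed.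

Lemma perm_meanZ c F : perm_mean (fun x => c * F x) = c * perm_mean F.
Proof. by rewrite /perm_mean -mulr_sumr mulrCA. Qed.

Lemma le_perm_mean F G : (forall x, F x <= G x) -> perm_mean F <= perm_mean G.
Proof.
move=> FG; rewrite /perm_mean ler_wpM2l ?invr_ge0//.
by apply: ler_sum => s _; exact: FG.
Qed.

Lemma perm_mean_sq (phi : R -> R) :
  perm_mean (fun x => phi (dot x x)) = phi k%:R.
Proof.
by rewrite -[RHS]perm_mean_cst; congr (_ * _); apply: eq_bigr => s _;
  rewrite sq_rank_vec.
Qed.

(** Reversing the order of the ranks is a bijection of the permutations that
    changes the sign of all scores. This is why third moments vanish. *)
Lemma perm_meanN F : perm_mean (fun x => F (- x)) = perm_mean F.
Proof.
congr (_ * _); pose rho := perm (@rev_ord_inj r).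
rewrite [RHS](reindex_inj (mulIg rho))/=; apply: eq_bigr => s _; congr F.
by apply/rowP => j; rewrite !mxE permM permE rank_score_rev.
Qed.

(** By exchangeability the covariance has one value on the diagonal and one
    off it. The trace is k, which gives the first; the sum of each row is 0,
    as the scores of a rank vector add up to 0, which gives the second. *)
Lemma sum_perm_score2 j l :
  \sum_(s : 'S_r) rank_score (s j) * rank_score (s l) =
  #|{: 'S_r}|%:R * ((j == l)%:R - r%:R^-1).
Proof.
pose M j l := \sum_(s : 'S_r) rank_score (s j) * rank_score (s l).
pose N : R := #|{: 'S_r}|%:R.
have Mperm (t : 'S_r) j' l' : M (t j') (t l') = M j' l'.
  rewrite /M [RHS](reindex_inj (mulgI t))/=.
  by apply: eq_bigr => s _; rewrite !permM.
have Mdiag j' : r%:R * M j' j' = N * k%:R.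
  have -> : N * k%:R = \sum_i M i i.
    rewrite exchange_big/= /N -[RHS]mulr1.
    rewrite (eq_bigr (fun=> k%:R)) => [|s _].
      by rewrite sumr_const -[k%:R *+ _]mulr_natl mulr1.
    by rewrite -(sq_rank_vec s); apply: eq_bigr => i _; rewrite !mxE.
  rewrite (eq_bigr (fun=> M j' j')) => [|i _].
    by rewrite sumr_const card_ord mulr_natl.
  by rewrite -[in LHS](tpermL j' i) Mperm.
have Msum j' : \sum_i M j' i = 0.
  rewrite exchange_big/= big1// => s _.
  rewrite -mulr_sumr (eq_bigr (fun i => rank_vec s 0 i)) => [|i _].
    by rewrite sum_rank_vec mulr0.
  by rewrite mxE.
have r0 : (r%:R : R) != 0 by rewrite pnatr_eq0.
have MN : M j j = N * (1 - r%:R^-1).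
  apply: (mulfI r0); rewrite Mdiag -natr1; field.
  by rewrite natr1 pnatr_eq0.
rewrite -/(M j l) -/N; have [<-//|jl] := eqVneq j l.
have := Msum j; rewrite (bigD1 j)//= MN.
rewrite (eq_bigr (fun=> M j l)) => [|i ij]; last first.
  rewrite -[in LHS](tpermL l i) -{1}(@tpermD _ l i j) ?Mperm//.
  by rewrite eq_sym.
rewrite sumr_const.
have -> : #|[pred i | i != j]| = k by rewrite -[LHS]/(#|predC1 j|) cardC1 card_ord.
rewrite -[M j l *+ _]mulr_natl => /eqP; rewrite addrC addr_eq0 => /eqP H.
have kN0 : (k%:R : R) != 0 by rewrite pnatr_eq0 -lt0n.
apply: (mulfI kN0); rewrite H -natr1; field.
by rewrite natr1 pnatr_eq0.
Qed.

Lemma perm_mean_dot_sqr w :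
  perm_mean (fun x => dot w x ^+ 2) =
  dot w w - (\sum_j w 0 j) ^+ 2 / r%:R.
Proof.
have N0 := card_perm_gt0; rewrite /perm_mean.
suff -> : \sum_(s : 'S_r) dot w (rank_vec s) ^+ 2 =
    #|{: 'S_r}|%:R * (dot w w - (\sum_j w 0 j) ^+ 2 / r%:R).
  by rewrite mulKf// gt_eqF.
transitivity (\sum_j \sum_l w 0 j * w 0 l *
    \sum_(s : 'S_r) rank_score (s j) * rank_score (s l)).
  under eq_bigr do rewrite expr2 mulr_suml.
  rewrite exchange_big/=; apply: eq_bigr => j _.
  under eq_bigr do rewrite mulr_sumr.
  rewrite exchange_big/=; apply: eq_bigr => l _.
  by rewrite mulr_sumr; apply: eq_bigr => s _; rewrite !mxE; ring.
under eq_bigr do under eq_bigr do rewrite sum_perm_score2 mulrCA.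
under eq_bigr do rewrite -mulr_sumr.
rewrite -mulr_sumr; congr (_ * _).
rewrite expr2 -mulrA !mulr_suml -sumrB; apply: eq_bigr => j _.
under eq_bigr do rewrite mulrBr.
rewrite sumrB; congr (_ - _).
  rewrite (bigD1 j)//= eqxx mulr1 big1 ?addr0// => l lj.
  by rewrite eq_sym (negbTE lj) mulr0.
by rewrite mulr_sumr; apply: eq_bigr => l _; rewrite mulrA.
Qed.

(** The reflection along this direction exchanges the last basis vector and
    the normalised all-ones vector. Hence it maps the other basis vectors to
    an orthonormal basis of the hyperplane of zero sum. *)
Definition refl_dir : V :=
  \row_j ((Num.sqrt r%:R)^-1 - (j == ord_max)%:R).

(** The image of the i-th basis vector under the reflection: the squared
    length of the direction is 2 (1 - 1 / sqrt r). *)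
Definition refl_row i : V :=
  delta_mx 0 i - ((1 - (Num.sqrt r%:R)^-1)^-1 * refl_dir 0 i) *: refl_dir.

Definition centered_basis : seq V :=
  [seq refl_row i | i <- enum 'I_r & i != ord_max].

Lemma dot_delta w i : dot w (delta_mx 0 i) = w 0 i.
Proof.
rewrite /dot (bigD1 i)//= mxE !eqxx mulr1 big1 ?addr0// => j ji.
by rewrite mxE eqxx (negbTE ji) mulr0.
Qed.

Let a : R := (Num.sqrt r%:R)^-1.

Let a2 : a ^+ 2 * r%:R = 1.
Proof. by rewrite /a exprVn sqr_sqrtr// mulVf// pnatr_eq0. Qed.

(* For k = 0 the two vectors to be exchanged coincide. *)
Let a1 : 1 - a != 0.
Proof.
rewrite subr_eq0; apply/eqP => ea; have := a2; rewrite -ea expr1n mul1r.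
move/eqP; rewrite -natr1 -subr_eq0 addrK pnatr_eq0 => /eqP ek.
by have := k0; rewrite ek.
Qed.

Lemma dot_refl_dir w : dot w refl_dir = a * (\sum_j w 0 j) - w 0 ord_max.
Proof.
rewrite -(dot_delta w ord_max) mulr_sumr -sumrB; apply: eq_bigr => j _.
by rewrite !mxE eqxx/= -/a; ring.
Qed.

Lemma sq_refl_dir : dot refl_dir refl_dir = 2 * (1 - a).
Proof.
rewrite dot_refl_dir (eq_bigr (fun j => a - (j == ord_max)%:R)) => [|j _];
  last by rewrite mxE.
rewrite sumrB sumr_const card_ord (bigD1 ord_max)//= eqxx big1 ?addr0 => [|j jm];
  last by rewrite (negbTE jm).
rewrite mxE eqxx -[a *+ _]mulr_natr; have := a2; rewrite /= -/a; nra.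
Qed.

Lemma dot_refl_row w i :
  dot w (refl_row i) = w 0 i - (1 - a)^-1 * refl_dir 0 i * dot w refl_dir.
Proof. by rewrite /refl_row dotDr dotNr dotZr dot_delta. Qed.

Lemma dot_refl_rows i j : dot (refl_row i) (refl_row j) = (i == j)%:R.
Proof.
rewrite dot_refl_row (dotC _ refl_dir) dot_refl_row sq_refl_dir !mxE eqxx /=.
rewrite eq_sym -/a; field.
exact: a1.
Qed.

Lemma refl_row_max w : dot w (refl_row ord_max) = a * \sum_j w 0 j.
Proof.
rewrite dot_refl_row dot_refl_dir !mxE eqxx /= -/a; field.
exact: a1.
Qed.

Lemma sum_sqr_refl_row w : \sum_i dot w (refl_row i) ^+ 2 = dot w w.
Proof.
under eq_bigr do rewrite dot_refl_row.
set D := dot w refl_dir.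
rewrite (eq_bigr (fun i => w 0 i * w 0 i - 2 * (1 - a)^-1 * D * (w 0 i * refl_dir 0 i) +
  ((1 - a)^-1 * D) ^+ 2 * (refl_dir 0 i * refl_dir 0 i))) => [|i _]; last by ring.
rewrite big_split sumrB/= -!mulr_sumr -!/(dot _ _) -/D sq_refl_dir; field.
exact: a1.
Qed.

Lemma size_centered_basis : size centered_basis = k.
Proof.
rewrite size_map size_filter -sum1_count big_enum_cond/=.
by rewrite (eq_bigl (mem (predC1 ord_max))) // sum1_card cardC1 card_ord.
Qed.

Lemma orthonormal_centered_basis : orthonormal centered_basis.
Proof.
rewrite /centered_basis; have : uniq [seq i <- enum 'I_r | i != ord_max].
  by rewrite filter_uniq// enum_uniq.
elim: [seq i <- enum 'I_r | i != ord_max] => [//|i s IH] /=.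
move=> /andP[iNs us]; split; last exact: IH.
  by rewrite dot_refl_rows eqxx.
move=> _ /mapP[j js ->]; rewrite dot_refl_rows.
by case: eqP => // ij; rewrite ij js in iNs.
Qed.

(** The reflected basis is orthonormal, so its squared coordinates add up to
    |w|^2; the one left out is the coordinate along the all-ones vector. *)
Lemma sum_sqr_centered_basis w :
  \sum_(e <- centered_basis) dot w e ^+ 2 =
  dot w w - (\sum_j w 0 j) ^+ 2 / r%:R.
Proof.
rewrite big_map big_filter big_enum_cond/= -sum_sqr_refl_row.
rewrite [in RHS](bigD1 ord_max)//= refl_row_max exprMn.
rewrite (_ : a ^+ 2 = r%:R^-1); last first.
  by apply: (mulIf (_ : r%:R != 0)); rewrite ?pnatr_eq0// a2 mulVf// pnatr_eq0.
by rewrite [r%:R^-1 * _]mulrC addrAC subrr add0r.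
Qed.

End rank_vectors.

(** * Means with the covariance of the projection onto the centred vectors *)

Section isotropic_means.
Variables (R : realType) (k : nat).
Notation r := k.+1.
Notation V := 'rV[R]_r.
Notation sq x := (dot x x).
Implicit Types (w x y : V) (F G : V -> R) (s t : R).
Let kR : R := k%:R.
Variables m2 m4 : R.

(** What the replacement argument uses about the law of one step, be it a
    rank vector or a Gaussian vector: symmetry, the covariance, and moments
    of |x|^2 of order 2 and 4 measured in powers of k. *)
Record isotropic_mean (E : (V -> R) -> R) : Prop := IsotropicMean {
  imeanD : forall F G, polylip F -> polylip G ->
    E (fun x => F x + G x) = E F + E G;
  imeanZ : forall c F, polylip F -> E (fun x => c * F x) = c * E F;
  imean_cst : forall c, E (fun=> c) = c;
  le_imean : forall F G, polylip F -> polylip G -> (forall x, F x <= G x) ->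
    E F <= E G;
  imeanN : forall F, polylip F -> E (fun x => F (- x)) = E F;
  imean_dot_sqr : forall w,
    E (fun x => dot w x ^+ 2) = dot w w - (\sum_j w 0 j) ^+ 2 / r%:R;
  imean_sq : E (fun x => sq x) = kR;
  imean_sq2 : E (fun x => sq x ^+ 2) <= m2 * kR ^+ 2;
  imean_sq4 : E (fun x => sq x ^+ 4) <= m4 * kR ^+ 4 }.

Hypothesis m4_ge1 : 1 <= m4.

Ltac polylip := repeat first
  [ exact: polylip_cst | exact: polylip_sq | exact: polylip_dotr
  | assumption
  | apply: polylipD | apply: polylipM | apply: polylipX ].

Lemma polylip_oppv F : polylip F -> polylip (fun x => F (- x)).
Proof.
move=> lF; apply: (@polylip_comp _ _ _ F (fun x => - x) 1) => // x y.
by rewrite mul1r -opprD normrN.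
Qed.

Lemma sq_shift w x s :
  sq (w + s *: x) = sq w + 2 * (s * dot w x) + s ^+ 2 * sq x.
Proof. by rewrite sqD sqZ dotZr. Qed.

Lemma sq_shiftN w x s :
  sq (w + s *: - x) = sq w - 2 * (s * dot w x) + s ^+ 2 * sq x.
Proof.
have sqN : sq (- x) = sq x by rewrite -scaleN1r sqZ sqrrN expr1n mul1r.
by rewrite sqD sqZ sqN dotZr dotNr; ring.
Qed.

Lemma dot_shift_le w x s : (s * dot w x) ^+ 2 <= sq w * (s ^+ 2 * sq x).
Proof. by rewrite exprMn [leRHS]mulrCA ler_wpM2l ?sqr_ge0// dot_sqr_le. Qed.

Lemma polylip_shift_sq w s : polylip (fun x => sq (w + s *: x)).
Proof. exact: (polylip_shift w s (@polylip_sq R r)). Qed.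

Section mean.
Variable E : (V -> R) -> R.
Hypothesis mE : isotropic_mean E.

(** Symmetrisation, which replaces the cancellation of odd moments by a
    pointwise cancellation. *)
Lemma imean_sym F : polylip F -> E F = E (fun x => (F x + F (- x)) / 2).
Proof.
move=> lF; have lFN := polylip_oppv lF.
rewrite (_ : (fun x => _) = (fun x => 2^-1 * (F x + F (- x)))).
  rewrite (imeanZ mE); last exact: polylipD.
  by rewrite (imeanD mE)// (imeanN mE)//; field.
by apply/funext => x; rewrite mulrC.
Qed.

Lemma imean_le_sym F G : polylip F -> polylip G ->
  (forall x, (F x + F (- x)) / 2 <= G x) -> E F <= E G.
Proof.
move=> lF lG FG; rewrite imean_sym//; apply: (le_imean mE) => //.
have lFN := polylip_oppv lF.
by apply: polylipM; [exact: polylipD|exact: polylip_cst].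
Qed.

Lemma imean_affine2 (a b c d : R) w :
  E (fun x => a + b * dot w x ^+ 2 + c * sq x + d * sq x ^+ 2) =
  a + b * (dot w w - (\sum_j w 0 j) ^+ 2 / r%:R) + c * kR +
    d * E (fun x => sq x ^+ 2).
Proof.
rewrite (imeanD mE); [|polylip..].
rewrite (imeanD mE); [|polylip..].
rewrite (imeanD mE); [|polylip..].
rewrite (imean_cst mE) !(imeanZ mE); [|polylip..].
by rewrite (imean_dot_sqr mE) (imean_sq mE).
Qed.

(** Symmetrised, |w + s x|^4 is (q + c)^2 + 4 b^2, at most q^2 + 6 q c +
    c^2. *)
Lemma imean_shift_sq2 w s :
  E (fun x => sq (w + s *: x) ^+ 2) <=
  sq w ^+ 2 + 6 * kR * s ^+ 2 * sq w + m2 * kR ^+ 2 * s ^+ 4.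
Proof.
have l1 := polylip_shift_sq w s.
apply: (@le_trans _ _ (E (fun x => sq w ^+ 2 + 0 * dot w x ^+ 2 +
    (6 * s ^+ 2 * sq w) * sq x + s ^+ 4 * sq x ^+ 2))).
  apply: imean_le_sym => [||x]; [polylip|polylip|].
  rewrite sq_shift sq_shiftN; have le := dot_shift_le w x s.
  rewrite [leRHS](_ : _ = sq w ^+ 2 + 6 * sq w * (s ^+ 2 * sq x) +
    (s ^+ 2 * sq x) ^+ 2); last by ring.
  move: (sq w) (s * dot w x) (s ^+ 2 * sq x) le => q b c le; lra.
rewrite imean_affine2 mul0r addr0.
have := ler_wpM2l (exprn_even_ge0 (n := 4) s isT) (imean_sq2 mE).
by lra.
Qed.

Lemma imean_shift_sq w s : E (fun x => sq (w + s *: x)) = sq w + s ^+ 2 * kR.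
Proof.
rewrite imean_sym; last exact: polylip_shift_sq.
transitivity (E (fun x => sq w + 0 * dot w x ^+ 2 + s ^+ 2 * sq x +
    0 * sq x ^+ 2)).
  by congr E; apply/funext => x; rewrite sq_shift sq_shiftN; field.
by rewrite imean_affine2 !mul0r !addr0.
Qed.

Section smooth.
Variables (h : R -> R) (M1 M2 M3 M4 : R).
Notation h_ j := (deriven_Rplus j h).
Hypothesis hh : forall j, (j < 4)%N -> forall x : R, 0 <= x ->
  derivable_Rplus (h_ j) x.
Hypothesis hM1 : forall x : R, 0 <= x -> `|h_ 1 x| <= M1.
Hypothesis hM2 : forall x : R, 0 <= x -> `|h_ 2 x| <= M2.
Hypothesis hM3 : forall x : R, 0 <= x -> `|h_ 3 x| <= M3.
Hypothesis hM4 : forall x : R, 0 <= x -> `|h_ 4 x| <= M4.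
Let H := M1 + 7 * M2 + 6 * M3 + M4.

Lemma polylip_radial : polylip (fun x => h (sq x)).
Proof.
have M10 : 0 <= M1 := le_trans (normr_ge0 _) (hM1 (lexx 0)).
apply: (polylip_lip M10 (@polylip_sq R r)) => x y.
by apply: (lipschitz_Rplus hh hM1); exact: sq_ge0.
Qed.

(** The main part only involves what is common to all symmetric laws with
    this covariance. The remainder is bounded pointwise after
    symmetrisation, by [taylor_sym] with c = s^2 |x|^2, and s <= 1 absorbs
    the power s^8. *)
Lemma imean_taylor w s : 0 <= s <= 1 ->
  `|E (fun x => h (sq (w + s *: x))) -
    (h (sq w) + h_ 1 (sq w) * (s ^+ 2 * kR) + 2 * h_ 2 (sq w) *
      (s ^+ 2 * (dot w w - (\sum_j w 0 j) ^+ 2 / r%:R)))| <=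
  H * s ^+ 4 * (m2 * kR ^+ 2 * (1 + 2 * sq w ^+ 2) + m4 * kR ^+ 4).
Proof.
move=> /andP[s0 s1].
have lF : polylip (fun x => h (sq (w + s *: x))).
  exact: (polylip_shift w s polylip_radial).
have lFN := polylip_oppv lF.
set q := sq w.
(* Main part and error bound, both of the shape whose mean is known. *)
pose A x := h q + (2 * h_ 2 q * s ^+ 2) * dot w x ^+ 2 +
  (h_ 1 q * s ^+ 2) * sq x + 0 * sq x ^+ 2.
pose B x := (H * s ^+ 4 * (1 + 2 * q ^+ 2)) * sq x ^+ 2 +
  (H * s ^+ 8) * sq x ^+ 4.
have lA : polylip A by rewrite /A; polylip.
have lB : polylip B by rewrite /B; polylip.
have pt x : `|(h (sq (w + s *: x)) + h (sq (w + s *: - x))) / 2 - A x| <= B x.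
  have := taylor_sym hh hM4 hM1 hM2 hM3 (sq_ge0 w)
    (mulr_ge0 (sqr_ge0 s) (sq_ge0 x)) (dot_shift_le w x s).
  rewrite sq_shift sq_shiftN -/q -/H /A /B.
  congr (`|_| <= _); first by ring.
  by ring.
have eA : E A = h q + h_ 1 q * (s ^+ 2 * kR) + 2 * h_ 2 q *
      (s ^+ 2 * (dot w w - (\sum_j w 0 j) ^+ 2 / r%:R)).
  by rewrite /A imean_affine2; ring.
have H0 : 0 <= H.
  have p1 := le_trans (normr_ge0 _) (hM1 (lexx 0)).
  have p2 := le_trans (normr_ge0 _) (hM2 (lexx 0)).
  have p3 := le_trans (normr_ge0 _) (hM3 (lexx 0)).
  have p4 := le_trans (normr_ge0 _) (hM4 (lexx 0)).
  by rewrite /H !addr_ge0// mulr_ge0.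
have eB : E B <= H * s ^+ 4 * (m2 * kR ^+ 2 * (1 + 2 * q ^+ 2) + m4 * kR ^+ 4).
  rewrite /B (imeanD mE); [|polylip..].
  rewrite !(imeanZ mE); [|polylip..].
  have c1 : 0 <= H * s ^+ 4 * (1 + 2 * q ^+ 2).
    by rewrite !mulr_ge0// ?exprn_ge0// addr_ge0// mulr_ge0// sqr_ge0.
  have c2 : 0 <= H * s ^+ 8 by rewrite mulr_ge0// exprn_ge0.
  have s84 : H * s ^+ 8 <= H * s ^+ 4.
    by rewrite ler_wpM2l// ler_wiXn2l.
  have e1 := ler_wpM2l c1 (imean_sq2 mE).
  have e2 := ler_wpM2l c2 (imean_sq4 mE).
  have e3 : H * s ^+ 8 * (m4 * kR ^+ 4) <= H * s ^+ 4 * (m4 * kR ^+ 4).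
    rewrite ler_wpM2r//; apply: mulr_ge0; first exact: le_trans ler01 m4_ge1.
    exact: exprn_ge0 (ler0n R k).
  apply: (le_trans (lerD e1 (le_trans e2 e3))).
  by rewrite le_eqVlt; apply/orP; left; apply/eqP; ring.
rewrite -eA; apply: le_trans eB; rewrite ler_distl; apply/andP; split.
  rewrite lerBlDr (imean_sym lF).
  have lS : polylip (fun x => (h (sq (w + s *: x)) + h (sq (w + s *: - x))) / 2).
    by apply: polylipM; [exact: polylipD|exact: polylip_cst].
  rewrite -(imeanD mE)//; apply: (le_imean mE) => //; first exact: polylipD.
  by move=> x; have := pt x; rewrite ler_distlC lerBlDr => /andP[].
rewrite -(imeanD mE)//.
apply: imean_le_sym => //; first exact: polylipD.
by move=> x; have := pt x; rewrite ler_distl => /andP[].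
Qed.

End smooth.

End mean.

End isotropic_means.

(** * Replacing rank vectors by Gaussian vectors *)

Section lindeberg.
Variables (R : realType) (k : nat).
Hypothesis k0 : (0 < k)%N.
Notation r := k.+1.
Notation V := 'rV[R]_r.
Notation sq x := (dot x x).
Implicit Types (w x y : V) (F G : V -> R) (s t : R).
Let kR : R := k%:R.
Let m2 : R := gmean (fun z => z ^+ 4).
Let m4 : R := gmean (fun z => z ^+ 8).
Let es := centered_basis R k.

Let m2_ge1 : 1 <= m2 := gmean_even_ge1 R 1.
Let m4_ge1 : 1 <= m4 := gmean_even_ge1 R 3.

(** The moments of |x|^2 hold with constants 1, as |x|^2 = k; the larger
    Gaussian constants m2 and m4 allow the same record for both laws. *)
Lemma isotropic_perm_mean : isotropic_mean m2 m4 (@perm_mean R k).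
Proof.
split.
- by move=> F G _ _; exact: perm_meanD.
- by move=> c F _; exact: perm_meanZ.
- exact: perm_mean_cst.
- by move=> F G _ _; exact: le_perm_mean.
- by move=> F _; exact: perm_meanN.
- exact: perm_mean_dot_sqr.
- by rewrite (perm_mean_sq k (fun z : R => z)).
- rewrite (perm_mean_sq k (fun z : R => z ^+ 2)).
  by rewrite ler_peMl// exprn_ge0.
- rewrite (perm_mean_sq k (fun z : R => z ^+ 4)).
  by rewrite ler_peMl// exprn_ge0.
Qed.

Lemma isotropic_vmean : isotropic_mean m2 m4 (vmean es).
Proof.
have oB := @orthonormal_centered_basis R k k0.
have sB := @size_centered_basis R k.
split.
- exact: vmeanD.
- exact: vmeanZ.
- exact: vmean_cst.
- exact: le_vmean.
- exact: vmeanN.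
- by move=> w; rewrite vmean_dot_sqr sum_sqr_centered_basis.
- by rewrite vmean_sq// sB.
- have := @vmean_sqX R r 1 m2 es _ (lexx _) oB; rewrite sB; apply=> c u v c0.
  by rewrite !expr1; exact: sqrD_weighted.
- have := @vmean_sqX R r 3 m4 es _ (lexx _) oB; rewrite sB; apply=> c u v c0.
  exact: X4D_weighted.
Qed.

Lemma ler_norm_vmean (l : seq V) F G : polylip F -> polylip G ->
  (forall x, `|F x| <= G x) -> `|vmean l F| <= vmean l G.
Proof.
move=> lF lG FG; rewrite ler_norml; apply/andP; split.
  rewrite -mulN1r -vmeanZ//; apply: le_vmean => // [|x]; first exact: polylipZ.
  by have := FG x; rewrite mulN1r ler_norml => /andP[].
by apply: le_vmean => // x; have := FG x; rewrite ler_norml => /andP[].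
Qed.

Lemma vmean_perm_mean (l : seq V) (G : V -> V -> R) :
  (forall x, polylip (G x)) ->
  perm_mean (fun x => vmean l (G x)) = vmean l (fun y => perm_mean (fun x => G x y)).
Proof.
move=> lG; rewrite /perm_mean vmeanZ; last by apply: polylip_sum => s; exact: lG.
congr (_ * _); elim: (index_enum _) => [|s e IH].
  rewrite big_nil; under [in RHS]eq_fun do rewrite big_nil.
  by rewrite vmean_cst.
rewrite big_cons IH; under [in RHS]eq_fun do rewrite big_cons.
by rewrite vmeanD//; apply: polylip_sum => s'; exact: lG.
Qed.

(** One step of the random walk, as an operator on functions: its n-th
    iterate at 0 is the expectation at the normalised sum of n rank vectors. *)
Definition step s F w := perm_mean (fun x => F (w + s *: x)).

Lemma iter_step_dist s (n : nat) F G B w :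
  (forall x, `|F x - G x| <= B x) ->
  `|iter n (step s) F w - iter n (step s) G w| <= iter n (step s) B w.
Proof.
move=> FG; elim: n w => [|n IH] w //=.
rewrite /step /perm_mean -mulrBr -sumrB normrM ger0_norm ?invr_ge0//.
rewrite ler_wpM2l ?invr_ge0// (le_trans (ler_norm_sum _ _ _))//.
by apply: ler_sum => s' _; exact: IH.
Qed.

Lemma le_iter_step s (n : nat) F G w : (forall x, F x <= G x) ->
  iter n (step s) F w <= iter n (step s) G w.
Proof.
move=> FG; elim: n w => [|n IH] w //=.
by apply: le_perm_mean => x; exact: IH.
Qed.

(** A polynomial bound for the fourth power of the length after steps of
    total variance t. Without its last coefficient 3 it is the Gaussian
    bound of [imean_shift_sq2]; the extra 3 k^2 t^2 compensates the increase
    6 k^2 t s^2 of the middle term in one step, as in (t + s^2)^2 = t^2 + 2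
    t s^2 + s^4. *)
Definition quartic t w :=
  sq w ^+ 2 + 6 * kR * t * sq w + (m2 + 3) * kR ^+ 2 * t ^+ 2.

Lemma step_quartic (c d : R) t s w : 0 <= d -> 0 <= t ->
  step s (fun x => c + d * quartic t x) w <= c + d * quartic (t + s ^+ 2) w.
Proof.
move=> d0 t0.
have -> : step s (fun x => c + d * quartic t x) w =
    c + d * (step s (fun x => sq x ^+ 2) w + 6 * kR * t * step s (fun x => sq x) w +
    (m2 + 3) * kR ^+ 2 * t ^+ 2).
  by rewrite /step /quartic perm_meanD perm_mean_cst perm_meanZ !perm_meanD
    perm_meanZ perm_mean_cst.
rewrite lerD2l ler_wpM2l//.
have h1 := imean_shift_sq2 isotropic_perm_mean w s.
have h2 := imean_shift_sq isotropic_perm_mean w s.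
rewrite /step h2 /quartic.
apply: (le_trans (lerD (lerD h1 (lexx _)) (lexx _))).
rewrite -subr_ge0.
have h4 : 0 <= kR ^+ 2 * t * s ^+ 2.
  by apply: mulr_ge0 (sqr_ge0 s); exact: mulr_ge0 (sqr_ge0 _) t0.
have h5 : 0 <= kR ^+ 2 * s ^+ 4.
  by apply: mulr_ge0 (sqr_ge0 _) _; exact: exprn_even_ge0.
rewrite [leRHS](_ : _ = 2 * m2 * (kR ^+ 2 * t * s ^+ 2) + 3 * (kR ^+ 2 * s ^+ 4));
  last by rewrite -/kR; ring.
apply: addr_ge0; apply: mulr_ge0 => //; apply: mulr_ge0 => //.
exact: le_trans ler01 m2_ge1.
Qed.

Lemma iter_step_quartic (c d : R) t s (n : nat) w : 0 <= d -> 0 <= t ->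
  iter n (step s) (fun x => c + d * quartic t x) w <=
  c + d * quartic (t + n%:R * s ^+ 2) w.
Proof.
move=> d0; elim: n t w => [|n IH] t w t0; first by rewrite mul0r addr0.
rewrite iterSr; apply: (@le_trans _ _ (iter n (step s)
    (fun x => c + d * quartic (t + s ^+ 2) x) w)).
  by apply: le_iter_step => x; exact: step_quartic.
apply: (le_trans (IH _ _ _)); first by rewrite addr_ge0// sqr_ge0.
by rewrite -addrA -natr1 mulrDl mul1r [s ^+ 2 + _]addrC.
Qed.

Section smooth.
Variables (h : R -> R) (M1 M2 M3 M4 : R).
Notation h_ j := (deriven_Rplus j h).
Hypothesis hh : forall j, (j < 4)%N -> forall x : R, 0 <= x ->
  derivable_Rplus (h_ j) x.
Hypothesis hM1 : forall x : R, 0 <= x -> `|h_ 1 x| <= M1.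
Hypothesis hM2 : forall x : R, 0 <= x -> `|h_ 2 x| <= M2.
Hypothesis hM3 : forall x : R, 0 <= x -> `|h_ 3 x| <= M3.
Hypothesis hM4 : forall x : R, 0 <= x -> `|h_ 4 x| <= M4.
Let H := M1 + 7 * M2 + 6 * M3 + M4.
Let g x := h (sq x).
Let lg : polylip g := polylip_radial k hh hM1.

Let H0 : 0 <= H.
Proof.
have p1 := le_trans (normr_ge0 _) (hM1 (lexx 0)).
have p2 := le_trans (normr_ge0 _) (hM2 (lexx 0)).
have p3 := le_trans (normr_ge0 _) (hM3 (lexx 0)).
have p4 := le_trans (normr_ge0 _) (hM4 (lexx 0)).
by rewrite /H !addr_ge0// mulr_ge0.
Qed.

Let alpha := m2 * kR ^+ 2 + m4 * kR ^+ 4.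
Let beta := 2 * m2 * kR ^+ 2.

Let m2_ge0 : 0 <= m2. Proof. exact: le_trans ler01 m2_ge1. Qed.

Let beta0 : 0 <= beta.
Proof. by apply: mulr_ge0 (sqr_ge0 _); exact: mulr_ge0. Qed.

Let c0 s : 0 <= 2 * H * s ^+ 4.
Proof. by apply: mulr_ge0; [exact: mulr_ge0|exact: exprn_even_ge0]. Qed.

(** Two instances of [imean_taylor] with the same main part. *)
Lemma vmean_step_dist s w : 0 <= s <= 1 ->
  `|vmean es (fun x => g (w + s *: x)) - step s g w| <=
  2 * H * s ^+ 4 * (alpha + beta * sq w ^+ 2).
Proof.
move=> s01.
have d1 := imean_taylor m4_ge1 isotropic_vmean hh hM1 hM2 hM3 hM4 w s01.
have d2 := imean_taylor m4_ge1 isotropic_perm_mean hh hM1 hM2 hM3 hM4 w s01.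
rewrite distrC in d2; have := lerD d1 d2.
move=> /(le_trans (ler_normD _ _)); rewrite addrA subrK => d.
apply: (le_trans d); rewrite le_eqVlt; apply/orP; left; apply/eqP.
by rewrite /alpha /beta /H; ring.
Qed.

(* Started at w, m Gaussian steps of size s. *)
Let f (m : nat) s w := vmean es (fun y => g (w + (Num.sqrt m%:R * s) *: y)).

(** Replacing one of m + 1 Gaussian steps by a rank step. By stability m + 1
    Gaussian steps are m of them followed by one more, and the rank step
    commutes with the m others, so [vmean_step_dist] applies after averaging
    over them. *)
Lemma vmean_swap_step (m : nat) s w : 0 < s <= 1 ->
  `|f m.+1 s w - step s (f m s) w| <=
  2 * H * s ^+ 4 * (alpha + beta * quartic (m%:R * s ^+ 2) w).
Proof.
move=> /andP[s0 s1]; set t := Num.sqrt m%:R * s.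
have t0 : 0 <= t by rewrite mulr_ge0 ?sqrtr_ge0// ltW.
have t2 : t ^+ 2 = m%:R * s ^+ 2 by rewrite exprMn sqr_sqrtr.
have e1 : f m.+1 s w =
    vmean es (fun y => vmean es (fun x => g ((w + t *: y) + s *: x))).
  have lgw : polylip (fun v => g (w + v)).
    by have := polylip_shift w 1 lg; under eq_fun do rewrite scale1r.
  have := vmean_conv es t0 s0 lgw; rewrite t2.
  rewrite -{2}[s ^+ 2]mul1r -mulrDl natr1 sqrtrM ?ler0n// sqrtr_sqr.
  rewrite (gtr0_norm s0) => e; rewrite /f -e.
  by apply: eq_vmean => y; apply: eq_vmean => x; rewrite addrA.
have e2 : step s (f m s) w = vmean es (fun y => step s g (w + t *: y)).
  rewrite /step /f -/t vmean_perm_mean => [|x].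
    by apply: eq_vmean => y; congr perm_mean; apply/funext => x; rewrite addrAC.
  exact: polylip_shift lg.
have lstep : polylip (step s g).
  apply: polylipM; first exact: polylip_cst.
  apply: polylip_sum => s'.
  by have := polylip_shift (s *: rank_vec R s') 1 lg;
    under eq_fun do rewrite scale1r addrC.
have lT : polylip (fun v => vmean es (fun x => g (v + s *: x))).
  exact: polylip_vmean lg.
have lsq : polylip (fun v : V => sq v ^+ 2) by apply/polylipX/polylip_sq.
rewrite e1 e2 -vmeanB; [|exact: (polylip_shift w t lT)|exact: (polylip_shift w t lstep)].
have lB : polylip (fun v : V => 2 * H * s ^+ 4 * (alpha + beta * sq v ^+ 2)).
  apply: polylipZ; apply: polylipD; first exact: polylip_cst.
  exact: (polylipZ beta lsq).
apply: (@le_trans _ _ (vmean es (fun y =>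
    2 * H * s ^+ 4 * (alpha + beta * sq (w + t *: y) ^+ 2)))).
  apply: ler_norm_vmean => [||x].
  - exact: (polylip_shift w t (polylipB lT lstep)).
  - exact: (polylip_shift w t lB).
  - by apply: vmean_step_dist; rewrite s1 ltW.
have lsqt := polylip_shift w t lsq.
have lqb := polylipZ beta lsqt; have la := polylip_cst V alpha.
rewrite (vmeanZ es _ (polylipD la lqb)) ler_wpM2l//.
rewrite (vmeanD es la lqb) vmean_cst (vmeanZ es _ lsqt) lerD2l ler_wpM2l//.
apply: (le_trans (imean_shift_sq2 isotropic_vmean w t)).
rewrite /quartic -t2 -exprM -/kR.
have h0 : 0 <= kR ^+ 2 * t ^+ 4.
  by apply: mulr_ge0 (sqr_ge0 _) _; exact: exprn_even_ge0.
rewrite -subr_ge0 [leRHS](_ : _ = 3 * (kR ^+ 2 * t ^+ 4)); last by ring.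
by rewrite mulr_ge0.
Qed.

(** Telescoping over i rank steps followed by n - i Gaussian ones. The i
    rank steps act on the error of the i-th replacement through [quartic]:
    the total variance never exceeds n s^2 = 1. *)
Lemma lindeberg_bound (n : nat) s : (0 < n)%N -> s = (Num.sqrt n%:R)^-1 ->
  `|iter n (step s) g 0 - vmean es g| <=
  2 * H * (alpha + beta * ((m2 + 3) * kR ^+ 2)) / n%:R.
Proof.
move=> n0 sE.
have nR0 : 0 < n%:R :> R by rewrite ltr0n.
have sn0 : 0 < Num.sqrt n%:R :> R by rewrite sqrtr_gt0.
have s0 : 0 < s by rewrite sE invr_gt0.
have s2 : n%:R * s ^+ 2 = 1.
  by rewrite sE exprVn sqr_sqrtr ?ler0n// divff// gt_eqF.
have s1 : s <= 1.
  rewrite -(@ler_pXn2r _ 2)// ?nnegrE ?(ltW s0)// expr1n -s2.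
  by rewrite ler_peMl ?sqr_ge0// ler1n.
have f0 : f 0 s = g.
  apply/funext => w; rewrite /f sqrtr0 mul0r.
  by under eq_fun do rewrite scale0r addr0; rewrite vmean_cst.
have fn : f n s 0 = vmean es g.
  rewrite /f sE divff ?gt_eqF//.
  by apply: eq_vmean => y; rewrite scale1r add0r.
set B := 2 * H * _ / _.
pose D i := iter i (step s) (f (n - i) s) 0.
have Dstep i : (i < n)%N -> `|D i.+1 - D i| <= 2 * H * s ^+ 4 *
    (alpha + beta * ((m2 + 3) * kR ^+ 2)).
  move=> i_n; rewrite distrC /D iterSr subnS.
  have [m nim] : exists m, (n - i)%N = m.+1.
    by exists (n - i).-1; rewrite prednK// subn_gt0.
  (* In what follows m Gaussian steps are left after the replaced one. *)
  rewrite nim/=.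
  have s01 : 0 < s <= 1 by rewrite s0.
  have := @iter_step_dist s i _ _ _ 0 (fun w => vmean_swap_step m w s01).
  move=> /le_trans; apply.
  pose c := 2 * H * s ^+ 4.
  rewrite (_ : (fun x => _) = (fun x => c * alpha + (c * beta) *
    quartic (m%:R * s ^+ 2) x)); last by apply/funext => x; rewrite /c; ring.
  apply: le_trans (iter_step_quartic _ s i 0 (mulr_ge0 (c0 s) beta0) _) _.
    by rewrite mulr_ge0// sqr_ge0.
  rewrite -mulrDl -natrD -/c [leRHS]mulrDr lerD2l -mulrA (ler_wpM2l (c0 s))//.
  rewrite (ler_wpM2l beta0)//.
  rewrite /quartic dot0r expr0n mulr0 !add0r.
  have mi : (m + i)%:R * s ^+ 2 <= 1.
    rewrite -[leRHS]s2 ler_wpM2r ?sqr_ge0// ler_nat.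
    by rewrite -ltnS -addSn -nim subnK// ltnW.
  rewrite ler_piMr//.
    by apply: mulr_ge0 (sqr_ge0 _); exact: addr_ge0.
  by rewrite expr_le1// mulr_ge0// sqr_ge0.
have : `|D n - D 0%N| <= n%:R * (2 * H * s ^+ 4 *
    (alpha + beta * ((m2 + 3) * kR ^+ 2))).
  suff : forall i, (i <= n)%N -> `|D i - D 0%N| <= i%:R * (2 * H * s ^+ 4 *
    (alpha + beta * ((m2 + 3) * kR ^+ 2))) by apply.
  elim=> [_|i IH i_n]; first by rewrite subrr normr0 mul0r.
  rewrite -[D i.+1](subrK (D i)) -addrA (le_trans (ler_normD _ _))//.
  rewrite -natr1 mulrDl mul1r [leRHS]addrC.
  by apply: lerD; [exact: Dstep|exact: IH (ltnW i_n)].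
rewrite {2}/D /= subn0 fn /D subnn f0.
move=> /le_trans; apply; rewrite le_eqVlt; apply/orP; left; apply/eqP.
rewrite /B.
have s2' : s ^+ 2 = n%:R^-1 by rewrite sE exprVn sqr_sqrtr.
have -> : s ^+ 4 = n%:R^-1 * n%:R^-1 by rewrite (exprM s 2 2) s2' expr2.
by field; rewrite gt_eqF.
Qed.

End smooth.

End lindeberg.

(** * The chi-square law as the law of a squared Gaussian norm *)

Section chi_square_mean.
Variable R : realType.
Local Notation N01 := (normal_prob (0 : R) 1).
Local Notation mR := (measurableTypeR R).
Implicit Types (H : R -> R) (M : R).

(** The constant is part of the predicate because Gaussian averaging does
    not increase it, which makes inductions on the degrees of freedom go
    through. *)
Definition lipschitz_const M H :=
  0 <= M /\ forall a b, `|H a - H b| <= M * `|a - b|.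

Lemma lipschitz_polylip M H : lipschitz_const M H -> polylip H.
Proof.
by move=> [M0 HM]; apply: (polylip_lip M0 (@polylip_id R)) => x y; exact: HM.
Qed.

Lemma lipschitz_shift_sqr M H y : lipschitz_const M H ->
  polylip (fun z : R => H (y + z ^+ 2)).
Proof.
move=> [M0 HM]; apply: (polylip_lip M0 (polylip_Xn R 2)) => x z.
by rewrite (le_trans (HM _ _))// opprD addrACA subrr add0r.
Qed.

Lemma lipschitz_gmean M H : lipschitz_const M H ->
  lipschitz_const M (fun y => gmean (fun z => H (y + z ^+ 2))).
Proof.
move=> HM; split=> [|a b]; first by case: HM.
have la := lipschitz_shift_sqr a HM; have lb := lipschitz_shift_sqr b HM.
rewrite -gmeanB//; have lab := polylipB la lb.
apply: (le_trans (ler_norm_gmean lab)).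
rewrite -[leRHS]gmean_cst; apply: le_gmean => [||z].
- exact: polylip_norm.
- exact: polylip_cst.
- by case: HM => _ HM; rewrite (le_trans (HM _ _))// opprD addrACA subrr addr0.
Qed.

Lemma lipschitz_norm M H : lipschitz_const M H ->
  lipschitz_const M (fun y => `|H y|).
Proof.
move=> [M0 HM]; split=> // a b.
exact: le_trans (ler_dist_dist _ _) (HM a b).
Qed.

Lemma lipschitz_measurable M H : lipschitz_const M H ->
  measurable_fun [set: mR] H.
Proof.
move=> /lipschitz_polylip/polylip_continuous; exact: continuous_measurable_fun.
Qed.

Lemma integrable_add_sqr (P : probability mR R) M H :
  (forall G, lipschitz_const M G -> P.-integrable setT (EFin \o G)) ->
  lipschitz_const M H ->
  (P \x N01)%E.-integrable setT ((EFin \o H) \o @add_sqr R).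
Proof.
move=> intP HM; have mH := lipschitz_measurable HM.
have mG : measurable_fun [set: mR * mR] ((EFin \o H) \o @add_sqr R).
  by apply/measurable_EFinP; exact: (measurableT_comp mH).
apply/integrable12ltyP => //.
have HN := lipschitz_norm HM.
have := intP _ (lipschitz_gmean HN).
move=> /integrableP[_]; apply: le_lt_trans.
apply: ge0_le_integral => //.
- by move=> y _; exact: integral_ge0.
- apply: (measurable_fun_fubini_tonelli_F (abse \o ((EFin \o H) \o @add_sqr R))).
    exact: (measurableT_comp (@abse_measurable R setT) mG).
  by move=> p; exact: abse_ge0.
- apply: (measurableT_comp (@abse_measurable R setT)); apply/measurable_EFinP.
  exact: lipschitz_measurable (lipschitz_gmean HN).
move=> y _; rewrite /= -EFin_gmean; last exact: lipschitz_shift_sqr HN.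
by rewrite lee_fin ler_norm.
Qed.

Lemma chi_square_integrable (k : nat) M H : lipschitz_const M H ->
  (chi_square_prob R k).-integrable setT (EFin \o H).
Proof.
elim: k H => [|k IH] H HM /=.
  apply/integrableP; split.
    by apply/measurable_EFinP; exact: lipschitz_measurable HM.
  rewrite integral_dirac//=; last first.
    by do 2 apply: measurableT_comp => //; exact: lipschitz_measurable HM.
  by rewrite diracT mul1e ltry.
apply: (integrable_pushforward (phi := @add_sqr R)) => //.
  by apply/measurable_EFinP; exact: lipschitz_measurable HM.
by rewrite preimage_setT; exact: (integrable_add_sqr IH HM).
Qed.

(** Both sides satisfy the same recursion: the law of Y + Z^2 on the left,
    [vmean_radial] on the right. *)
Lemma integral_chi_square (r : nat) (es : seq 'rV[R]_r) M H :
  orthonormal es -> lipschitz_const M H ->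
  (\int[chi_square_prob R (size es)]_y (H y)%:E =
   (vmean es (fun x => H (dot x x)))%:E)%E.
Proof.
elim: es M H => [|e es IH] M H oes HM.
  rewrite /= integral_dirac//; last first.
    by apply/measurable_EFinP; exact: lipschitz_measurable HM.
  by rewrite diracT mul1e dot0r.
have mH := lipschitz_measurable HM.
rewrite (vmean_radial H)//.
have oes' : orthonormal es by case: oes.
rewrite -(IH _ _ oes' (lipschitz_gmean HM)).
have intH := integrable_add_sqr (fun G => @chi_square_integrable (size es) M G) HM.
rewrite [chi_square_prob R (size (e :: es))]/=.
rewrite integral_distribution//; last exact/measurable_EFinP.
rewrite -integral12_prod_meas1//; apply: eq_integral => y _.
by rewrite EFin_gmean//; exact: lipschitz_shift_sqr HM.
Qed.

Lemma chi_square_lt0 (k : nat) :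
  chi_square_prob R k `]-oo, (0 : R)[%classic = 0%E.
Proof.
elim: k => [|k IH] /=.
  by rewrite diracE memNset//= in_itv/= ltxx.
rewrite /distribution /pushforward.
apply: (@subset_measure0 _ _ _ (chi_square_prob R k \x N01)%E _
  (`]-oo, (0 : R)[%classic `*` [set: mR])).
- by rewrite -[X in measurable X]setTI; apply: measurable_add_sqr.
- exact: measurableX.
- move=> -[y z] /=; rewrite !in_itv/= /add_sqr/= => yz; split=> //.
  by have := sqr_ge0 z; lra.
- transitivity (chi_square_prob R k `]-oo, 0%R[%classic * N01 [set: mR])%E.
    exact: product_measure1E.
  by rewrite IH mul0e.
Qed.

(** Only the values of h on the half-line are known to be regular, so h is
    replaced by its extension, which is harmless as the chi-square law does
    not charge the negative numbers. *)
Lemma integral_chi_square_halfline (r : nat) (es : seq 'rV[R]_r) M (h : R -> R) :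
  orthonormal es -> 0 <= M ->
  (forall x y, 0 <= x -> 0 <= y -> `|h x - h y| <= M * `|x - y|) ->
  (\int[chi_square_prob R (size es)]_(y in `[0%R, +oo[) (h y)%:E =
   (vmean es (fun x => h (dot x x)))%:E)%E.
Proof.
move=> oes M0 hM.
have HM : lipschitz_const M (clip0 h).
  split=> // a b; rewrite /clip0 (le_trans (hM _ _ _ _)) ?le_max ?lexx//.
  by rewrite ler_wpM2l// clip0_lip.
transitivity (\int[chi_square_prob R (size es)]_(y in `[0%R, +oo[)
    (clip0 h y)%:E)%E.
  apply: eq_integral => y; rewrite inE/= in_itv/= andbT => y0.
  by rewrite clip0E.
have -> : `[0%R, +oo[%classic = [set: mR] `\` `]-oo, (0 : R)[%classic.
  by rewrite setTD setCitvl.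
rewrite -negligible_integral//; last 2 first.
- exact: chi_square_integrable HM.
- exact: chi_square_lt0.
rewrite (integral_chi_square oes HM); congr (_%:E); apply: eq_vmean => x.
by rewrite clip0E// sq_ge0.
Qed.

End chi_square_mean.

(** * The law of Friedman's statistic *)

Section finite_average.
Variables (R : realType) (k : nat).
Notation r := k.+1.
Notation V := 'rV[R]_r.
Implicit Types (w : V) (F : V -> R).
Local Notation N := (#|{: 'S_r}|%:R : R).

Definition ffun_cons (n : nat) (p : 'S_r * {ffun 'I_n -> 'S_r}) :
    {ffun 'I_n.+1 -> 'S_r} :=
  [ffun i => if unlift ord0 i is Some j then p.2 j else p.1].

Lemma ffun_cons_bij (n : nat) : bijective (@ffun_cons n).
Proof.
exists (fun g : {ffun 'I_n.+1 -> 'S_r} =>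
  (g ord0, [ffun j : 'I_n => g (lift ord0 j)])) => [[s f]|g].
  congr (_, _); first by rewrite ffunE unlift_none.
  by apply/ffunP => j; rewrite !ffunE liftK.
apply/ffunP => i; rewrite ffunE/=.
by case: unliftP => [j|] ->; rewrite ?ffunE.
Qed.

(** An n-tuple of permutations is a first permutation and an (n-1)-tuple;
    the average over the first one is the outermost step. *)
Lemma iter_step_ffun (n : nat) (s : R) F w :
  iter n (step s) F w = (N ^+ n)^-1 *
    \sum_(f : {ffun 'I_n -> 'S_r}) F (w + s *: \sum_i rank_vec R (f i)).
Proof.
elim: n F w => [|n IH] F w.
  rewrite expr0 invr1 mul1r (big_pred1 ([ffun=> 1%g] : {ffun 'I_0 -> 'S_r})) => [|f].
    by rewrite big_ord0 scaler0 addr0.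
  by apply/esym/eqP/ffunP => -[].
rewrite (reindex _ (onW_bij _ (ffun_cons_bij n)))/=.
rewrite -(pair_bigA _ (fun s0 f =>
  F (w + s *: \sum_i rank_vec R (ffun_cons (s0, f) i))))/=.
rewrite exprS invfM -mulrA /step /perm_mean; congr (_ * _).
rewrite [RHS]mulr_sumr; apply: eq_bigr => s0 _.
rewrite IH; congr (_ * _); apply: eq_bigr => f _; congr F.
rewrite [X in _ = _ + s *: X]big_ord_recl scalerDr addrA ffunE unlift_none/=.
by congr (_ + s *: _); apply: eq_bigr => i _; rewrite ffunE liftK.
Qed.

Lemma friedman_F_sq (n : nat) (f : 'I_n -> 'S_r) :
  friedman_F R f = dot ((Num.sqrt n%:R)^-1 *: \sum_i rank_vec R (f i))
    ((Num.sqrt n%:R)^-1 *: \sum_i rank_vec R (f i)).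
Proof.
apply: eq_bigr => j _; rewrite expr2 /friedman_W !mxE summxE.
by congr (_ * _ * (_ * _)); apply: eq_bigr => i _; rewrite mxE.
Qed.

End finite_average.

Section expectation_average.
Variables (R : realType) (r n : nat).
Context d (Omega : measurableType d) (P : probability Omega R).
Variable p : 'I_n -> Omega -> 'S_r.
Hypothesis p_rv : forall i, perm_rv (p i).
Hypothesis p_unif : forall i, uniform_perm P (p i).
Hypothesis p_indep : independent_perms P p.
Local Notation N := (#|{: 'S_r}|%:R : R).

Let A (f : {ffun 'I_n -> 'S_r}) : set Omega :=
  [set w | forall i, p i w \in [set f i]%SET].

Let mA f : measurable (A f).
Proof.
rewrite (_ : A f = \bigcap_(i in [set: 'I_n]) [set w | p i w \in [set f i]%SET]).
  by apply: fin_bigcap_measurable => // i _; exact: p_rv.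
by apply/seteqP; split=> w /= h i; [move=> _|]; exact: h.
Qed.

Let PA f : P (A f) = ((N ^+ n)^-1)%:E.
Proof.
have := p_indep [set: 'I_n]%SET (fun i => [set f i]%SET).
rewrite (_ : [set w | _] = A f); last first.
  apply/seteqP; split=> w /= h i; first by apply: h; rewrite inE.
  by move=> _; exact: h.
move=> ->; rewrite (eq_bigr (fun=> (N^-1)%:E)) => [|i _]; last first.
  rewrite -(p_unif i (f i)); congr (P _); apply/seteqP; split=> w /=.
    by rewrite inE => /eqP.
  by move=> ->; rewrite inE.
rewrite prodEFin/= big_const cardsT card_ord iter_mulr_1 exprVn//.
Qed.

(** The events that all the permutations take given values partition the
    sample space, and by independence each has probability N^(-n), N = r!. *)
Lemma expectation_perms (G : {ffun 'I_n -> 'S_r} -> R) :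
  ('E_P[fun w => G [ffun i => p i w]] =
   ((N ^+ n)^-1 * \sum_f G f)%:E)%E.
Proof.
rewrite unlock.
transitivity (\int[P]_w \sum_(f : {ffun 'I_n -> 'S_r})
    ((G f)%:E * (\1_(A f) w)%:E))%E.
  apply: eq_integral => w _; rewrite (bigD1 [ffun i => p i w])//=.
  rewrite indicE mem_set ?mule1; last first.
    by move=> i; rewrite ffunE inE.
  rewrite big1 ?adde0// => f fp; rewrite indicE memNset ?mule0// => h.
  move/eqP: fp; apply; apply/ffunP => i; rewrite ffunE.
  by have := h i; rewrite inE => /eqP.
have intA f : P.-integrable setT (fun w => (\1_(A f) w)%:E).
  by apply: integrable_indic.
rewrite integral_sum//; last by move=> f; exact: integrableZl.
rewrite mulr_sumr -sumEFin; apply: eq_bigr => f _.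
rewrite integralZl// integral_indic// setIT.
transitivity ((G f)%:E * ((N ^+ n)^-1)%:E)%E; first by congr (_ * _)%E; exact: PA.
by rewrite -EFinM mulrC.
Qed.

End expectation_average.

Section derivative_norms.
Variable R : realType.
Implicit Types h : R -> R.

Lemma supnorm_Rplus_ge0 h : (0 <= supnorm_Rplus h)%E.
Proof.
apply: (@le_trans _ _ (`|h 0|%:E)); first by rewrite lee_fin.
by apply: ereal_sup_ubound; exists 0 => //=; rewrite in_itv/= lexx.
Qed.

Lemma le_supnorm_Rplus h (x : R) : 0 <= x -> (`|h x|%:E <= supnorm_Rplus h)%E.
Proof.
by move=> x0; apply: ereal_sup_ubound; exists x => //=; rewrite in_itv/= x0.
Qed.

Lemma fin_num_weighted_sum (a b c e : \bar R) :
  (0 <= a -> 0 <= b -> 0 <= c -> 0 <= e ->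
   a + 7%:E * b + 6%:E * c + e != +oo ->
   [/\ a \is a fin_num, b \is a fin_num, c \is a fin_num & e \is a fin_num])%E.
Proof.
move=> a0 b0 c0 e0; rewrite -ltey => fin.
have b70 : (0 <= 7%:E * b)%E by exact: mule_ge0.
have c60 : (0 <= 6%:E * c)%E by exact: mule_ge0.
have ab0 := adde_ge0 a0 b70; have abc0 := adde_ge0 ab0 c60.
have abc := le_lt_trans (leeDl _ e0) fin.
have ab := le_lt_trans (leeDl _ c60) abc.
rewrite !ge0_fin_numE//; split.
- exact: le_lt_trans (leeDl _ b70) ab.
- apply: le_lt_trans (le_lt_trans (leeDr _ a0) ab).
  by apply: lee_pemull => //; rewrite lee_fin ler1n.
- apply: le_lt_trans (le_lt_trans (leeDr _ ab0) abc).
  by apply: lee_pemull => //; rewrite lee_fin ler1n.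
- exact: le_lt_trans (leeDr _ abc0) fin.
Qed.

Lemma EFin_weighted_sum (a b c e : \bar R) (A B C E : R) :
  a = A%:E -> b = B%:E -> c = C%:E -> e = E%:E ->
  (a + 7%:E * b + 6%:E * c + e = (A + 7 * B + 6 * C + E)%:E)%E.
Proof. by move=> -> -> -> ->. Qed.

Lemma hnorm4E h : hnorm h 4 =
  (supnorm_Rplus (deriven_Rplus 1 h) + 7%:E * supnorm_Rplus (deriven_Rplus 2 h) +
   6%:E * supnorm_Rplus (deriven_Rplus 3 h) +
   supnorm_Rplus (deriven_Rplus 4 h))%E.
Proof.
have s1 : stirling2 R 4 1 = 1.
  rewrite /stirling2 !big_nat_recr//= big_nil ?subSS ?subn0.
  by rewrite (_ : 'C(1, 0) = 1%N)// (_ : 'C(1, 1) = 1%N)// (_ : 1`! = 1%N)//; field.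
have s2 : stirling2 R 4 2 = 7.
  rewrite /stirling2 !big_nat_recr//= big_nil ?subSS ?subn0.
  rewrite (_ : 'C(2, 0) = 1%N)// (_ : 'C(2, 1) = 2%N)// (_ : 'C(2, 2) = 1%N)//.
  by rewrite (_ : 2`! = 2%N)//; field.
have s3 : stirling2 R 4 3 = 6.
  rewrite /stirling2 !big_nat_recr//= big_nil ?subSS ?subn0.
  rewrite (_ : 'C(3, 0) = 1%N)// (_ : 'C(3, 1) = 3%N)// (_ : 'C(3, 2) = 3%N)//.
  by rewrite (_ : 'C(3, 3) = 1%N)// (_ : 3`! = 6%N)//; field.
have s4 : stirling2 R 4 4 = 1.
  rewrite /stirling2 !big_nat_recr//= big_nil ?subSS ?subn0.
  rewrite (_ : 'C(4, 0) = 1%N)// (_ : 'C(4, 1) = 4%N)// (_ : 'C(4, 2) = 6%N)//.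
  rewrite (_ : 'C(4, 3) = 4%N)// (_ : 'C(4, 4) = 1%N)// (_ : 4`! = 24%N)//.
  by field.
rewrite /hnorm big_nat_recr//= big_nat_recr//= big_nat_recr//= big_nat_recr//=.
by rewrite big_geq// add0e s1 s2 s3 s4 !mul1e.
Qed.

End derivative_norms.

(** The bound with real numbers in place of supremum norms. It is of order
    r^4 / n, one power of r better than what is finally claimed. *)
Lemma friedman_chi_square_dist (R : realType) (k n : nat) d
    (Omega : measurableType d) (P : probability Omega R)
    (p : 'I_n -> Omega -> 'S_k.+1) (h : R -> R) (M1 M2 M3 M4 : R) :
  let m2 : R := gmean (fun z => z ^+ 4) in
  let m4 : R := gmean (fun z => z ^+ 8) in
  (0 < k)%N -> (0 < n)%N ->
  (forall i, perm_rv (p i)) -> (forall i, uniform_perm P (p i)) ->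
  independent_perms P p ->
  (forall j, (j < 4)%N -> forall x : R, 0 <= x ->
    derivable_Rplus (deriven_Rplus j h) x) ->
  (forall x : R, 0 <= x -> `|deriven_Rplus 1 h x| <= M1) ->
  (forall x : R, 0 <= x -> `|deriven_Rplus 2 h x| <= M2) ->
  (forall x : R, 0 <= x -> `|deriven_Rplus 3 h x| <= M3) ->
  (forall x : R, 0 <= x -> `|deriven_Rplus 4 h x| <= M4) ->
  (`| 'E_P[fun w => h (friedman_F R (fun i => p i w))]
      - \int[chi_square_prob R k]_(x in `[0%R, +oo[) (h x)%:E | <=
   (2 * (M1 + 7 * M2 + 6 * M3 + M4) *
     (m2 * k%:R ^+ 2 + m4 * k%:R ^+ 4 +
      2 * m2 * k%:R ^+ 2 * ((m2 + 3) * k%:R ^+ 2)) / n%:R)%:E)%E.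
Proof.
move=> m2 m4 k0 n0 p_rv p_unif p_indep hD hM1 hM2 hM3 hM4.
have oB := @orthonormal_centered_basis R k k0.
have M10 : 0 <= M1 := le_trans (normr_ge0 _) (hM1 0 (lexx 0)).
have chi := integral_chi_square_halfline oB M10 (lipschitz_Rplus hD hM1).
rewrite size_centered_basis in chi; rewrite chi.
pose g (x : 'rV[R]_k.+1) := h (dot x x).
have -> : ('E_P[fun w => h (friedman_F R (fun i => p i w))] =
    (iter n (step (Num.sqrt n%:R)^-1) g 0)%:E)%E.
  rewrite iter_step_ffun -(expectation_perms p_rv p_unif p_indep).
  congr ('E_P[_])%E; apply/funext => w; rewrite /g add0r -friedman_F_sq.
  by congr (h (friedman_F R _)); apply/funext => i; rewrite ffunE.
rewrite -EFinB/= lee_fin.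
exact: (lindeberg_bound k0 hD hM1 hM2 hM3 hM4 n0 erefl).
Qed.

(** Since k >= 1, every term is at most a multiple of k^4, with total factor
    2 * 15 + 2 * 1214 + 4 * 15 * (15 + 3) = 3538. *)
Lemma constant_bound (R : realType) (m2 m4 H N K : R) (k : nat) :
  (0 < k)%N -> 0 <= m2 <= 15 -> 0 <= m4 <= 1214 -> 0 <= H -> 0 < N -> 3538 <= K ->
  2 * H * (m2 * k%:R ^+ 2 + m4 * k%:R ^+ 4 +
    2 * m2 * k%:R ^+ 2 * ((m2 + 3) * k%:R ^+ 2)) / N <=
  K * k.+1%:R ^+ 5 * N^-1 * H.
Proof.
move=> k0 /andP[m20 m2u] /andP[m40 m4u] H0 N0 K8.
rewrite [leRHS](_ : _ = H * (K * k.+1%:R ^+ 5) / N); last by ring.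
rewrite ler_pM2r ?invr_gt0// -mulrA mulrCA ler_wpM2l//.
rewrite -[k.+1%:R]natr1; have k1 : 1 <= k%:R :> R by rewrite ler1n.
move: (k%:R : R) k1 => u u1.
have u0 : 0 <= u := le_trans ler01 u1.
have u2 : u ^+ 2 <= u ^+ 4 by rewrite ler_weXn2l.
have u4 : 0 <= u ^+ 4 by rewrite exprn_ge0.
have u5 : u ^+ 4 <= (u + 1) ^+ 5.
  apply: (@le_trans _ _ ((u + 1) ^+ 4)).
    by rewrite lerXn2r ?nnegrE ?addr_ge0// lerDl.
  by rewrite ler_weXn2l// lerDr.
have e1 : m2 * u ^+ 2 <= 15 * u ^+ 4 by rewrite ler_pM ?sqr_ge0.
have e2 : m4 * u ^+ 4 <= 1214 * u ^+ 4 by rewrite ler_wpM2r.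
have e3 : m2 * (m2 + 3) <= 15 * (15 + 3).
  exact: ler_pM m20 (addr_ge0 m20 (ler0n R 3)) m2u (lerD m2u (lexx 3)).
have e4 := ler_wpM2r u4 e3.
apply: (@le_trans _ _ (3538 * u ^+ 4)).
  rewrite [leLHS](_ : _ = 2 * (m2 * u ^+ 2) + 2 * (m4 * u ^+ 4) +
    4 * (m2 * (m2 + 3) * u ^+ 4)); last by ring.
  by clear -e1 e2 e4; lra.
by apply: ler_pM; [exact: ler0n|exact: u4|exact: K8|exact: u5].
Qed.

Theorem theorem3p1 (R : realType) (r n : nat) (hr : (2 <= r)%N) (hn : (1 <= n)%N)
    (d : measure_display) (Omega : measurableType d) (P : probability Omega R)
    (p : 'I_n -> Omega -> 'S_r)
    (p_rv : forall i, perm_rv (p i))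
    (p_unif : forall i, uniform_perm P (p i))
    (p_indep : independent_perms P p)
    (h : R -> R) (hh : Cb_Rplus 4 h) :
  (`| 'E_P[fun w => h (friedman_F R (fun i => p i w))]
      - \int[chi_square_prob R r.-1]_(x in `[0%R, +oo[) (h x)%:E |
   <= (10797 * r%:R ^+ 5 * n%:R^-1)%:E * hnorm h 4)%E.
Proof.
case: r hr p p_rv p_unif p_indep => [//|k] k0 p p_rv p_unif p_indep.
have {}k0 : (0 < k)%N by [].
have n0 : 0 < n%:R :> R by rewrite ltr0n.
(* A variable stands for the large numeral, to keep computations small. *)
have [K KE] : exists K : R, K = 10797 by exists 10797.
have K8 : 3538 <= K by rewrite KE; lra.
rewrite -KE; clear KE.
have c0 : 0 < K * k.+1%:R ^+ 5 * n%:R^-1.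
  by rewrite !mulr_gt0 ?exprn_gt0 ?invr_gt0 ?ltr0n//; lra.
(* An infinite norm makes the right-hand side infinite. *)
have [->|] := eqVneq (hnorm h 4) +oo%E; first by rewrite gt0_muley ?lte_fin ?leey.
have supE (j : nat) : supnorm_Rplus (deriven_Rplus j h) \is a fin_num ->
    exists2 M, supnorm_Rplus (deriven_Rplus j h) = M%:E &
    forall x : R, 0 <= x -> `|deriven_Rplus j h x| <= M.
  move=> /fineK e; exists (fine (supnorm_Rplus (deriven_Rplus j h))) => // x x0.
  by rewrite -lee_fin e le_supnorm_Rplus.
rewrite hnorm4E => hfin.
have S1 := supnorm_Rplus_ge0 (deriven_Rplus 1 h).
have S2 := supnorm_Rplus_ge0 (deriven_Rplus 2 h).
have S3 := supnorm_Rplus_ge0 (deriven_Rplus 3 h).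
have S4 := supnorm_Rplus_ge0 (deriven_Rplus 4 h).
have : [/\ supnorm_Rplus (deriven_Rplus 1 h) \is a fin_num,
  supnorm_Rplus (deriven_Rplus 2 h) \is a fin_num,
  supnorm_Rplus (deriven_Rplus 3 h) \is a fin_num &
  supnorm_Rplus (deriven_Rplus 4 h) \is a fin_num].
  exact: fin_num_weighted_sum S1 S2 S3 S4 hfin.
move=> [f1 f2 f3 f4].
have [M1 e1 hM1] := supE 1%N f1.
have [M2 e2 hM2] := supE 2%N f2.
have [M3 e3 hM3] := supE 3%N f3.
have [M4 e4 hM4] := supE 4%N f4.
have hD (j : nat) : (j < 4)%N -> forall x : R, 0 <= x ->
    derivable_Rplus (deriven_Rplus j h) x.
  by case: hh => hh4 _ j4 x x0; apply: hh4; rewrite // in_itv/= x0.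
have le1 := friedman_chi_square_dist k0 hn p_rv p_unif p_indep hD hM1 hM2 hM3 hM4.
apply: (le_trans le1); rewrite (EFin_weighted_sum e1 e2 e3 e4) -EFinM lee_fin.
apply: constant_bound => //.
- by rewrite gmean_X4 andbT; exact: le_trans ler01 (gmean_even_ge1 R 1).
- by rewrite gmean_X8 andbT; exact: le_trans ler01 (gmean_even_ge1 R 3).
have M10 : 0 <= M1 := le_trans (normr_ge0 _) (hM1 0 (lexx 0)).
have M20 : 0 <= M2 := le_trans (normr_ge0 _) (hM2 0 (lexx 0)).
have M30 : 0 <= M3 := le_trans (normr_ge0 _) (hM3 0 (lexx 0)).
have M40 : 0 <= M4 := le_trans (normr_ge0 _) (hM4 0 (lexx 0)).
by rewrite !addr_ge0// mulr_ge0.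
Qed.
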